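(* There exists a monotone $(1,\gamma(1)+0.0003)$-balanced contention resolution scheme for the general matching polytope, i.e., for every finite graph $G$ there is a monotone $(1,\gamma(1)+0.0003)$-balanced CR scheme for $P_{\mathcal M(G)}$, where $\gamma(1)=\frac{1-e^{-2}}{2}$.
   Context: Graphs may have parallel edges (no loops). $\mathcal{M}(G)$ is the family of matchings of $G$ and $P_{\mathcal{M}(G)}$ its matching polytope (convex hull of incidence vectors of matchings). For $x\in[0,1]^E$, $R(x)$ is a random subset of $E$ containing each $e$ independently with probability $x_e$. A $(b,c)$-balanced CR scheme for $P=P_{\mathcal F}$ is a procedure that for every $x\in bP$ and $A\subseteq\mathrm{supp}(x)$ returns a (possibly random) $\pi_x(A)\subseteq A$ with $\pi_x(A)\in\mathcal F$ such that $\Pr[e\in\pi_x(R(x))]\ge c\,x_e$ for all $e\in\mathrm{supp}(x)$; it is monotone if for all $x\in bP$, $\Pr[e\in\pi_x(A)]\ge\Pr[e\in\pi_x(B)]$ whenever $e\in A\subseteq B\subseteq\mathrm{supp}(x)$. *)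

(* Defs.v *)
From HB Require Import structures.
From mathcomp Require Import all_boot all_order all_algebra.
From mathcomp Require Import reals sequences.

Set Implicit Arguments.
Unset Strict Implicit.
Unset Printing Implicit Defensive.

Import Order.TTheory GRing.Theory Num.Theory.

Local Open Scope ring_scope.

(* Loopless: every edge has exactly two endpoints.  Parallel edges are allowed,
   since distinct elements of [edge G] may have the same endpoints. *)
Record multigraph := Multigraph {
  vertex : finType;
  edge : finType;
  ends : edge -> {set vertex};
  card_ends : forall e : edge, #|ends e| = 2%N
}.

Definition matchings (G : multigraph) : {set {set edge G}} :=
  [set M : {set edge G} |
    [forall e in M, forall f in M, (e != f) ==> [disjoint ends e & ends f]]].

Record fdist (R : realType) (T : finType) := Fdist {
  mass :> {ffun T -> R};
  mass_ge0 : forall t, 0 <= mass t;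
  mass_sum1 : \sum_t mass t = 1
}.

Definition Pr (R : realType) (T : finType) (p : fdist R T) (Q : pred T) : R :=
  \sum_(t | Q t) p t.

Section ContentionResolution.

Variables (R : realType) (E : finType).

Definition incidence (S : {set E}) : {ffun E -> R} :=
  [ffun e => (e \in S)%:R].

(* Convex hull of the incidence vectors of the members of F; the coefficients
   of a convex combination form a distribution concentrated on F. *)
Definition polytope (F : {set {set E}}) (x : {ffun E -> R}) : Prop :=
  exists2 lam : fdist R {set E},
    forall S : {set E}, S \notin F -> lam S = 0 &
    forall e, x e = \sum_S lam S * incidence S e.

Definition scaled_polytope (b : R) (F : {set {set E}}) (x : {ffun E -> R})
  : Prop :=
  exists2 y, polytope F y & forall e, x e = b * y e.

Definition supp (x : {ffun E -> R}) : {set E} := [set e | x e != 0].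

(* Pr[R(x) = A], where R(x) contains each e independently with probability
   x e; meaningful for x in [0,1]^E. *)
Definition Pr_rset (x : {ffun E -> R}) (A : {set E}) : R :=
  \prod_e (if e \in A then x e else 1 - x e).

(* pi x A is the law of the random set pi_x(A).  Only its values for x in bP
   and A included in supp x are ever constrained. *)
Definition selector := {ffun E -> R} -> {set E} -> fdist R {set E}.

(* Pr[e \in pi_x(R(x))]; the internal randomness of pi_x is independent of
   R(x). *)
Definition Pr_selected (pi : selector) (x : {ffun E -> R}) (e : E) : R :=
  \sum_(A : {set E}) Pr_rset x A * Pr (pi x A) [pred S : {set E} | e \in S].

Definition balanced_CR_scheme (b c : R) (F : {set {set E}}) (pi : selector)
  : Prop :=
  forall x, scaled_polytope b F x ->
    (forall A : {set E}, A \subset supp x ->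
       forall S : {set E}, pi x A S != 0 -> (S \subset A) && (S \in F)) /\
    (forall e, e \in supp x -> c * x e <= Pr_selected pi x e).

Definition monotone_selector (b : R) (F : {set {set E}}) (pi : selector)
  : Prop :=
  forall x, scaled_polytope b F x ->
  forall (e : E) (A B : {set E}),
    e \in A -> A \subset B -> B \subset supp x ->
    Pr (pi x B) [pred S : {set E} | e \in S]
      <= Pr (pi x A) [pred S : {set E} | e \in S].

End ContentionResolution.

(* Main.v *)
Require Import Defs.
From mathcomp Require Import all_boot all_order all_algebra all_fingroup.
From mathcomp Require Import ring lra zify.
From mathcomp Require Import reals sequences exp.

(** If every edge carries an independent random clock, the edges whose clock
    rings before those of all adjacent edges form a matching, and an edge wins
    less often when more edges are present.  With exponential clocks stopped at
    time 1 (here: geometric clocks on 4n slots) an edge e of a point x wins with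
    probability about x_e (1 - exp (-s)) / s, where s <= 2 is the weight of the
    edges meeting e; this is where (1 - exp (-2)) / 2 comes from.

    The extra 0.0003 comes from correlating clocks.  Suppose e = uv has exactly
    two adjacent edges f1 and f2, one at each end and disjoint.  The clocks of
    e, f1, f2 can be made pairwise independent but jointly biased so that e wins
    more often.  Any other edge k sees at most two of the three, so its chances
    do not change.  Monotonicity survives as well: deleting f2 only leaves e to
    compete with f1, and e beats f1 alone with the unbiased probability.
    The biased triples must be disjoint; to this end the vertices are ranked at
    random and e is biased only if u and v outrank the far ends of f1 and f2,
    which happens with probability 1/6.  The configuration itself has
    probability bounded below because x(delta(u)), x(delta(v)) are close to 1
    and x(uw) + x(vw) <= 1 for every w; if they are not close to 1, then s is
    smaller than 2 and the basic scheme gains already. *)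

Import Order.TTheory GRing.Theory Num.Theory.
Local Open Scope ring_scope.

Set Implicit Arguments.
Unset Strict Implicit.
Unset Printing Implicit Defensive.

(** * Expectations over random sets and clocks *)

Section ProductSums.

Variable R : realType.

Lemma natr_forall (I : finType) (P Q : pred I) :
  [forall i in P, Q i]%:R = \prod_(i in P) (Q i)%:R :> R.
Proof.
apply/esym; case: (boolP [forall i in P, Q i]) => [/forallP h|].
  by rewrite big1 // => i iP; have := h i; rewrite iP /= => ->.
rewrite negb_forall => /existsP[i]; rewrite negb_imply => /andP[iP nQ].
by rewrite (bigD1 i) //= (negbTE nQ) mul0r.
Qed.

Lemma Pr_rset_ge0 (E : finType) (z : {ffun E -> R}) (S : {set E}) :
  (forall e, 0 <= z e <= 1) -> 0 <= Pr_rset z S.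
Proof.
move=> hz; apply: prodr_ge0 => e _; have /andP[z0 z1] := hz e.
by case: ifP => _ //; rewrite subr_ge0.
Qed.

(** Distributivity: expanding the right-hand product gives one term per [S]. Expectations over
    [R(z)] are computed below by bringing the integrand into this product form. *)
Lemma sum_Pr_rset (E : finType) (z : {ffun E -> R}) (a b : E -> R) :
  \sum_(S : {set E}) Pr_rset z S * \prod_e (if e \in S then a e else b e)
  = \prod_e (z e * a e + (1 - z e) * b e).
Proof.
rewrite (bigA_distr _ _ (fun e => z e * a e)) /=; apply: eq_bigr => S _.
by rewrite -big_split /=; apply: eq_bigr => e _; case: ifP.
Qed.

Lemma sum_Pr_rset1 (E : finType) (z : {ffun E -> R}) :
  \sum_(S : {set E}) Pr_rset z S = 1.
Proof.
have := sum_Pr_rset z (fun=> 1) (fun=> 1).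
rewrite (eq_bigr (fun S => Pr_rset z S)) => [->|S _].
  by rewrite big1 // => e _; ring.
by rewrite big1 ?mulr1 // => e _; case: ifP.
Qed.

(* R(masked theta A) is the thinning of [A] that keeps e with probability theta e. *)
Definition masked (E : finType) (theta : E -> R) (A : {set E}) : {ffun E -> R} :=
  [ffun e => (e \in A)%:R * theta e].

(** Both stages of sampling act independently on each edge, so they merge into a single one. *)
Lemma sum_Pr_rset_masked (E : finType) (x : {ffun E -> R}) (theta : E -> R)
    (S : {set E}) :
  \sum_(A : {set E}) Pr_rset x A * Pr_rset (masked theta A) S
  = Pr_rset [ffun e => x e * theta e] S.
Proof.
(* The factor of [e] in the probability that the thinning of [A] equals [S] is [a e] for [e] in [A]
   and [b e] otherwise. *)
pose a e := if e \in S then theta e else 1 - theta e.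
pose b e : R := if e \in S then 0 else 1.
rewrite (eq_bigr (fun A : {set E} => Pr_rset x A *
   \prod_e (if e \in A then a e else b e))) => [|A _].
  rewrite sum_Pr_rset; apply: eq_bigr => e _; rewrite ffunE /a /b.
  by case: ifP => _; ring.
congr (_ * _); apply: eq_bigr => e _; rewrite !ffunE /a /b.
by case: (e \in A); case: (e \in S); rewrite ?mul1r ?mul0r ?subr0.
Qed.

(** Needed for monotonicity: a thinning of [B] yields by intersection a thinning of [A], so the two
    instances can be compared on a common sample. *)
Lemma sum_Pr_rset_restrict (E : finType) (theta : E -> R) (A B : {set E})
    (g : {set E} -> R) : A \subset B ->
  \sum_(S : {set E}) Pr_rset (masked theta B) S * g (S :&: A)
  = \sum_(S : {set E}) Pr_rset (masked theta A) S * g S.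
Proof.
move=> /subsetP AB.
rewrite (partition_big (fun S => S :&: A) xpredT) //=; apply: eq_bigr => T _.
rewrite (eq_bigr (fun S => Pr_rset (masked theta B) S * g T)); last first.
  by move=> S /eqP <-.
rewrite -big_distrl /=; congr (_ * _).
pose a e : R := ((e \in A) == (e \in T))%:R.
pose b e : R := (false == (e \in T))%:R.
rewrite big_mkcond /=.
rewrite (eq_bigr (fun S : {set E} => Pr_rset (masked theta B) S *
   \prod_e (if e \in S then a e else b e))) => [|S _].
  rewrite sum_Pr_rset; apply: eq_bigr => e _; rewrite !ffunE /a /b.
  case: (boolP (e \in A)) => [/AB ->|_]; case: (e \in T) => /=;
    rewrite ?mul1r ?mul0r ?mulr1 ?mulr0; try ring.
have -> : (S :&: A == T) = [forall e in predT, ((e \in S) && (e \in A)) == (e \in T)].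
  apply/eqP/forallP => [<- e|h]; first by rewrite !inE eqxx.
  by apply/setP => e; rewrite inE; have := h e => /= /eqP.
have -> : \prod_e (if e \in S then a e else b e) =
    \prod_(e in predT) (((e \in S) && (e \in A)) == (e \in T))%:R.
  by apply: eq_bigr => e _; rewrite /a /b; case: (e \in S).
by rewrite -natr_forall; case: ifP => _; rewrite ?mulr1 ?mulr0.
Qed.

End ProductSums.

Section ClockSums.

Variables (R : realType) (E : finType) (N : nat).
Variable p : E -> 'I_N -> R.
Hypothesis p_sum1 : forall e, \sum_i p e i = 1.

Local Notation clocks := {ffun E -> 'I_N}.

Definition upd (t : clocks) (z : E) (i : 'I_N) : clocks :=
  [ffun e => if e == z then i else t e].

Lemma upd_neq t z i e : e != z -> upd t z i e = t e.
Proof. by move=> ez; rewrite ffunE (negbTE ez). Qed.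

(** The involution [sw] exchanges the clock of [z] with the spare value [i]. *)
Lemma sum_upd (F : clocks -> R) (z : E) :
  \sum_t \sum_i F (upd t z i) = N%:R * \sum_t F t.
Proof.
rewrite pair_big /=.
pose sw (ti : clocks * 'I_N) := (upd ti.1 z ti.2, ti.1 z).
have swK : involutive sw.
  move=> [t i]; rewrite /sw /=; congr pair; last by rewrite ffunE eqxx.
  by apply/ffunP => e; rewrite !ffunE; case: eqP => // ->.
rewrite (reindex_inj (inv_inj swK)) /=.
have -> : \sum_j F (upd (upd j.1 z j.2) z (j.1 z)) =
   \sum_(j : clocks * 'I_N) F j.1.
  apply: eq_bigr => -[t i] _ /=; congr F.
  by apply/ffunP => e; rewrite !ffunE; case: eqP => // ->.
rewrite -(pair_big xpredT xpredT (fun t (i : 'I_N) => F t)) /= mulr_sumr.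
by apply: eq_bigr => t _; rewrite sumr_const card_ord mulr_natl.
Qed.

Definition indep_of (T : Type) (g : clocks -> T) (z : E) := forall t i, g (upd t z i) = g t.

(** Resample the clock of [z] by [sum_upd]: all other factors are constant in it, so the mean of [a]
    comes out as a factor 0. *)
Lemma sum_indep0 (a : 'I_N -> R) (g : clocks -> R) (z : E) :
    \sum_i p z i * a i = 0 -> indep_of g z ->
  \sum_(t : clocks) (\prod_e p e (t e)) * (a (t z) * g t) = 0.
Proof.
move=> a0 gz.
(* For [N = 0] the factor [N] of [sum_upd] cannot be cancelled, but then there are no clocks at
   all. *)
have [N0|N0] := posnP N.
  by rewrite big1 // => t _; exfalso; have := leq_ltn_trans (leq0n _) (ltn_ord (t z)); rewrite N0.
have N0' : N%:R != 0 :> R by rewrite pnatr_eq0 -lt0n.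
apply/(mulfI N0'); rewrite mulr0.
rewrite -(sum_upd (fun t => (\prod_e p e (t e)) * (a (t z) * g t)) z).
rewrite big1 // => t _.
rewrite (eq_bigr (fun i => (\prod_(e | e != z) p e (t e)) * g t * (p z i * a i))).
  by rewrite -mulr_sumr a0 mulr0.
move=> i _; rewrite gz (bigD1 z) //= !ffunE eqxx.
rewrite (eq_bigr (fun e => p e (t e))); first by ring.
by move=> e ez; rewrite upd_neq.
Qed.

(** Once the clock of [k] is fixed, the clocks of [M] are independent and their factors average
    separately. *)
Lemma sum_star (k : E) (M : {set E}) (b : 'I_N -> R) (a : E -> 'I_N -> 'I_N -> R) :
    k \notin M ->
  \sum_(t : clocks) (\prod_e p e (t e)) * (b (t k) * \prod_(f in M) a f (t k) (t f))
  = \sum_i p k i * b i * \prod_(f in M) \sum_j p f j * a f i j.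
Proof.
move=> kM.
(* The indicator [j == i] fixes the clock of [k], so that for each [i] the summand is a product over
   all edges. *)
pose F i e j := p e j * (if e == k then (j == i)%:R * b i else
                          if e \in M then a e i j else 1).
transitivity (\sum_(t : clocks) \sum_i \prod_e F i e (t e)).
  apply: eq_bigr => t _; rewrite [RHS](bigD1 (t k)) //= [X in _ + X]big1 ?addr0; last first.
    move=> i ik; rewrite (bigD1 k) //= /F eqxx eq_sym (negbTE ik).
    by rewrite !(mul0r, mulr0).
  rewrite /F big_split /=; congr (_ * _).
  rewrite [RHS](bigD1 k) //= !eqxx mul1r; congr (_ * _).
  rewrite [RHS](eq_bigr (fun e => if e \in M then a e (t k) (t e) else 1));
    last by move=> e /negbTE ->.
  rewrite -big_mkcondr /=; apply: eq_bigl => e.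
  by case: eqP => // ->; rewrite (negbTE kM).
rewrite exchange_big /=; apply: eq_bigr => i _.
rewrite -(bigA_distr_bigA (F i)) (bigD1 k) //=; congr (_ * _).
  rewrite (bigD1 i) //= big1 ?addr0; first by rewrite /F !eqxx mul1r.
  by move=> j /negbTE ji; rewrite /F eqxx ji mul0r mulr0.
rewrite [LHS](eq_bigr (fun e => if e \in M then \sum_j p e j * a e i j else 1)).
  rewrite -big_mkcondr /=; apply: eq_bigl => e.
  by case: eqP => // ->; rewrite (negbTE kM).
move=> e /negbTE ek; rewrite /F ek; case: (e \in M) => //.
by rewrite -[RHS](p_sum1 e); apply: eq_bigr => j _; rewrite mulr1.
Qed.

End ClockSums.

(** * Local minima of correlated clocks *)

Section LocalMinima.

Variable G : multigraph.
Local Notation edges := {set edge G}.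

Definition adj (e f : edge G) := (e != f) && ~~ [disjoint ends e & ends f].

Definition nbr (e : edge G) : edges := [set f | adj e f].

Lemma adjC e f : adj e f = adj f e.
Proof. by rewrite /adj eq_sym disjoint_sym. Qed.

Lemma adjxx e : adj e e = false.
Proof. by rewrite /adj eqxx. Qed.

Variable rho : vertex G -> nat.

(* The neighbourhood [M] of [k] consists of one edge at each end of [k], the
   two are disjoint, and the ends of [k] outrank their far ends. *)
Definition central (k : edge G) (M : edges) : bool :=
  [&& #|M| == 2, M \in matchings G &
     [forall a in ends k, forall f in M, forall b in ends f :\: ends k,
        (rho b < rho a)%N]].

Lemma matchings_disjoint (M : edges) e f :
  M \in matchings G -> e \in M -> f \in M -> e != f -> [disjoint ends e & ends f].
Proof.
rewrite inE => /forallP/(_ e)/implyP h eM fM ef.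
by move: (h eM) => /forallP/(_ f)/implyP/(_ fM)/implyP; apply.
Qed.

Lemma central_label k (M : edges) a f b : central k M ->
  a \in ends k -> f \in M -> b \in ends f -> b \notin ends k -> (rho b < rho a)%N.
Proof.
case/and3P=> _ _ /forallP/(_ a)/implyP h ak fM bf bk.
move: (h ak) => /forallP/(_ f)/implyP/(_ fM)/forallP/(_ b)/implyP; apply.
by rewrite inE bk.
Qed.

Lemma central_other k (M : edges) f : central k M -> f \in M ->
  exists2 g, g \in M & [disjoint ends f & ends g] /\ g != f.
Proof.
case/and3P=> /eqP c2 mM _ fM.
have : (0 < #|M :\ f|)%N by move: c2; rewrite (cardsD1 f) fM add1n => -[->].
case/card_gt0P => g; rewrite in_setD1 => /andP[gf gM]; exists g => //.
by split=> //; apply: matchings_disjoint mM _ _ _ => //; rewrite eq_sym.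
Qed.

Variable S : edges.

Local Notation nbS k := (S :&: nbr k).

Definition centres : edges := [set c in S | central c (nbS c)].

Definition star (c : edge G) : edges := c |: nbS c.

Lemma not_disjointP (T : finType) (A B : {set T}) :
  ~~ [disjoint A & B] -> exists2 x, x \in A & x \in B.
Proof. by rewrite -setI_eq0 => /set0Pn[x]; rewrite inE => /andP[]; exists x. Qed.

(** The other edge [g] at [c] is disjoint from [c'], so the end of [c] on [g] is private. In
    particular [c'] is not parallel to [c]. *)
Lemma private_end c c' : c \in centres -> c' \in nbS c ->
  exists2 v, v \in ends c & v \notin ends c'.
Proof.
rewrite inE => /andP[cS cc] c'N; have [g gN [dg gc']] := central_other cc c'N.
move: (gN); rewrite !inE => /andP[_ /andP[_ /not_disjointP[v vc vg]]].
by exists v => //; apply: contraTN vg; move/(disjointFr dg)=> ->.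
Qed.

(** Adjacent centres would each own a private end, and each of these two vertices would have to
    outrank the other. *)
Lemma centres_nadj c c' : c \in centres -> c' \in centres -> ~~ adj c c'.
Proof.
move=> hc hc'; apply/negP => cc'; have c'c := cc'; rewrite adjC in c'c.
have [cS ac] : c \in S /\ central c (nbS c) by move: hc; rewrite inE => /andP.
have [c'S ac'] : c' \in S /\ central c' (nbS c') by move: hc'; rewrite inE => /andP.
have c'N : c' \in nbS c by rewrite !inE c'S.
have cN : c \in nbS c' by rewrite !inE cS.
have [v vc vc'] := private_end hc c'N.
have [w wc' wc] := private_end hc' cN.
have wv := central_label ac vc c'N wc' wc.
by have := ltn_trans wv (central_label ac' wc' cN vc vc'); rewrite ltnn.
Qed.

(** A common neighbour [z] would join an end [u] of [c] to an end [w] of [c']. Each of [u], [w] is a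
    far end of [z] for the opposite centre, so each would rank below the other. *)
Lemma star_disjoint c c' z : c \in centres -> c' \in centres -> c != c' ->
  z \in star c -> z \notin star c'.
Proof.
move=> hc hc' cc'; have nadj := centres_nadj hc hc'.
have [cS ac] : c \in S /\ central c (nbS c) by move: hc; rewrite inE => /andP.
have [c'S ac'] : c' \in S /\ central c' (nbS c') by move: hc'; rewrite inE => /andP.
have dj : [disjoint ends c & ends c'] by move: nadj; rewrite /adj cc' /= negbK.
rewrite in_setU1 => /orP[/eqP ->|zN]; apply/negP; rewrite in_setU1 => /orP[].
- by rewrite (negbTE cc').
- by rewrite !inE cS /= adjC (negbTE nadj).
- move=> /eqP zc'; move: zN; rewrite zc' !inE c'S /= => h.
  by rewrite h in nadj.
move=> zN'; move: (zN) (zN'); rewrite !inE.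
move=> /andP[_ /andP[_ /not_disjointP[u uc uz]]].
move=> /andP[_ /andP[_ /not_disjointP[w wc' wz]]].
have uc' : u \notin ends c' by rewrite (disjointFr dj uc).
have wc : w \notin ends c by rewrite (disjointFl dj wc').
have wu := central_label ac uc zN wz wc.
by have := ltn_trans wu (central_label ac' wc' zN' uz uc'); rewrite ltnn.
Qed.

(** Whether [k] rings first depends only on the clocks in its own star. So one clock in the star of
    any other centre [c] stays unseen: that of [c] if [k] does not meet [c], else that of the
    neighbour of [c] disjoint from [k]. *)
Lemma star_escape c k : c \in centres -> k \in S -> k != c ->
  exists2 z, z \in star c & z \notin star k.
Proof.
move=> hc kS kc; have [cS ac] : c \in S /\ central c (nbS c).
  by move: hc; rewrite inE => /andP.
have [ck|nck] := boolP (adj c k); last first.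
  exists c; first by rewrite in_setU1 eqxx.
  by rewrite !inE negb_or negb_and eq_sym kc /= adjC nck orbT.
have kN : k \in nbS c by rewrite !inE kS.
have [g gN [dg gk]] := central_other ac kN; exists g; first by rewrite in_setU1 gN orbT.
by rewrite !inE negb_or gk /= /adj dg andbF andbF.
Qed.

Section Law.

Variables (R : realType) (N : nat) (p a b : edge G -> 'I_N -> R).
Hypothesis p_ge0 : forall e i, 0 <= p e i.
Hypothesis p_sum1 : forall e, \sum_i p e i = 1.
Hypothesis pa0 : forall e, \sum_i p e i * a e i = 0.
Hypothesis pb0 : forall e, \sum_i p e i * b e i = 0.
Hypothesis a_le1 : forall e i, `|a e i| <= 1.
Hypothesis b_le1 : forall e i, `|b e i| <= 1.

Local Notation clocks := {ffun edge G -> 'I_N}.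

(* Any two of the clocks in the star of a centre remain independent under this
   perturbation, but the three of them together do not. *)
Definition tilt (c : edge G) (t : clocks) : R :=
  b c (t c) * \prod_(f in nbS c) a f (t f).

Definition clock_law (t : clocks) : R :=
  (\prod_e p e (t e)) * \prod_(c in centres) (1 + tilt c t).

(** Ties count as losses for both edges, so that the winners always form a matching. *)
Definition first (t : clocks) (k : edge G) : bool :=
  [forall f in nbS k, (t k < t f)%N].

Definition local_minima (t : clocks) : edges := [set k in S | first t k].

Lemma local_minima_matching t : local_minima t \in matchings G.
Proof.
rewrite inE; apply/forallP => e; apply/implyP; rewrite inE => /andP[eS /forallP he].
apply/forallP => f; apply/implyP; rewrite inE => /andP[fS /forallP hf].
apply/implyP => ef; apply/negPn/negP => nd.
have := he f; have := hf e; rewrite !inE eS fS /= /adj ef (eq_sym f) ef /=.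
by rewrite nd disjoint_sym nd /= => ef' fe; have := ltn_trans ef' fe; rewrite ltnn.
Qed.

Lemma clock_law_ge0 t : 0 <= clock_law t.
Proof.
apply: mulr_ge0; apply: prodr_ge0 => c _ //.
suff : `|tilt c t| <= 1 by rewrite ler_norml; lra.
rewrite normrM normr_prod mulr_ile1 ?normr_ge0 ?prodr_ge0 //.
by apply: prodr_ile1 => f _; rewrite normr_ge0 a_le1.
Qed.

Lemma tilt_indep c z : z \notin star c -> indep_of (tilt c) z.
Proof.
rewrite in_setU1 negb_or => /andP[zc zN] t i; rewrite /tilt upd_neq 1?eq_sym //.
congr (_ * _); apply: eq_bigr => f fN; rewrite upd_neq //.
by apply: contraNneq zN => <-.
Qed.

Lemma first_indep k z : z \notin star k -> indep_of (first^~ k) z.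
Proof.
rewrite in_setU1 negb_or => /andP[zk zN] t i; apply: eq_forallb => f.
case fN: (f \in nbS k) => //=; rewrite !upd_neq // 1?eq_sym //.
by apply: contraNneq zN => ->.
Qed.

(** Integrating out the clock of [z] alone leaves the mean of [b c] or of [a z], which is 0. *)
Lemma sum_tilt0 c z (g : clocks -> R) : z \in star c -> indep_of g z ->
  \sum_(t : clocks) (\prod_e p e (t e)) * (tilt c t * g t) = 0.
Proof.
rewrite in_setU1 => /orP[/eqP ->|zN] gz.
  under eq_bigr => t _ do rewrite /tilt -mulrA.
  apply: sum_indep0 => // t i; rewrite gz; congr (_ * _).
  apply: eq_bigr => f; rewrite !inE => /andP[_ cf]; rewrite upd_neq //.
  by apply: contraTneq cf => ->; rewrite adjxx.
pose g' (t : clocks) := b c (t c) * \prod_(f in nbS c | f != z) a f (t f) * g t.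
transitivity (\sum_(t : clocks) (\prod_e p e (t e)) * (a z (t z) * g' t)).
  by apply: eq_bigr => t _; rewrite /tilt /g' (bigD1 z zN) /= -!mulrA [b c _ * _]mulrCA.
apply: sum_indep0 => // t i; rewrite /g' gz; congr (_ * _ * _).
  rewrite upd_neq //; apply: contraTneq zN => <-.
  by rewrite !inE adjxx andbF.
by apply: eq_bigr => f /andP[_ fz]; rewrite upd_neq.
Qed.

(** Tilts are removed one at a time: the clock [z] chosen for [c] is read neither by [g] nor, stars
    being disjoint, by the remaining tilts, so the part containing [tilt c] sums to 0. *)
Lemma sum_tilted (J : edges) (g : clocks -> R) : J \subset centres ->
    (forall c, c \in J -> exists2 z, z \in star c & indep_of g z) ->
  \sum_(t : clocks) (\prod_e p e (t e)) * (\prod_(c in J) (1 + tilt c t) * g t)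
  = \sum_(t : clocks) (\prod_e p e (t e)) * g t.
Proof.
move: {2}#|J| (erefl #|J|) => n; elim: n J => [|n IHn] J cJ JC gJ.
  move/eqP: cJ; rewrite cards_eq0 => /eqP ->.
  by apply: eq_bigr => t _; rewrite big_set0 mul1r.
have /card_gt0P[c cJ'] : (0 < #|J|)%N by rewrite cJ.
have [z zc gz] := gJ c cJ'.
have JC' : J :\ c \subset centres by apply: subset_trans JC; apply: subsetDl.
rewrite -[RHS](IHn (J :\ c)) //; first last.
- by move=> c'; rewrite in_setD1 => /andP[_]; apply: gJ.
- by move: cJ; rewrite (cardsD1 c) cJ' => -[].
have := @sum_tilt0 c z (fun t => \prod_(c' in J :\ c) (1 + tilt c' t) * g t) zc.
move=> h; rewrite -[RHS]addr0 -[X in _ = _ + X]h => [|t i]; last first.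
  rewrite gz; congr (_ * _); apply: eq_bigr => c'; rewrite in_setD1 => /andP[cc' c'J].
  rewrite tilt_indep //; apply: star_disjoint zc; rewrite ?(subsetP JC) //.
  by rewrite eq_sym.
rewrite -big_split /=; apply: eq_bigr => t _.
by rewrite (big_setD1 c) //=; ring.
Qed.

Lemma clock_law_sum1 : \sum_t clock_law t = 1.
Proof.
rewrite -[LHS]addr0; have := @sum_tilted centres (fun=> 1) (subxx _).
under eq_bigr do rewrite mulr1; move=> -> => [|c cC]; last first.
  by exists c => //; rewrite in_setU1 eqxx.
under eq_bigr do rewrite mulr1.
by rewrite -(bigA_distr_bigA p) big1 ?addr0 // => e _; rewrite p_sum1.
Qed.

(** All tilts but that of [k] itself average out by [star_escape]; the rest involves only the star
    of [k] and is computed by conditioning on the clock of [k]. *)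
Lemma clock_law_first k : k \in S ->
  \sum_(t | first t k) clock_law t
  = \sum_i p k i * \prod_(f in nbS k) \sum_(j : 'I_N | (i < j)%N) p f j
    + (central k (nbS k))%:R *
      \sum_i p k i * b k i * \prod_(f in nbS k) \sum_(j : 'I_N | (i < j)%N) p f j * a f j.
Proof.
move=> kS.
pose I t : R := (first t k)%:R.
pose g t : R := (1 + (central k (nbS k))%:R * tilt k t) * I t.
transitivity (\sum_(t : clocks) (\prod_e p e (t e)) *
    (\prod_(c in centres :\ k) (1 + tilt c t) * g t)).
  rewrite big_mkcond /=; apply: eq_bigr => t _; rewrite /clock_law /g /I.
  case: (first t k); rewrite ?mulr0 // !mulr1; congr (_ * _).
  case: (boolP (k \in centres)) => kC; last first.
    have -> : central k (nbS k) = false by move: kC; rewrite inE kS => /negbTE.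
    rewrite mul0r addr0 mulr1; apply: eq_bigl => c; rewrite in_setD1.
    by case: eqP => // ->; rewrite (negbTE kC).
  have -> : central k (nbS k) by move: kC; rewrite inE kS.
  by rewrite (big_setD1 k) //= mul1r mulrC.
rewrite sum_tilted; first last.
- move=> c; rewrite in_setD1 => /andP[ck cC].
  have [z zc zk] := @star_escape c k cC kS (negbT (etrans (eq_sym _ _) (negbTE ck))).
  exists z => // t i; rewrite /g /I first_indep // tilt_indep //.
- exact: subsetDl.
have kN : k \notin nbS k by rewrite !inE adjxx andbF.
have I_prod t : I t = \prod_(f in nbS k) ((t k < t f)%N)%:R by rewrite /I natr_forall.
transitivity
  (\sum_(t : clocks) (\prod_e p e (t e)) *
      (1 * \prod_(f in nbS k) ((t k < t f)%N)%:R) +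
   (central k (nbS k))%:R * \sum_(t : clocks) (\prod_e p e (t e)) *
      (b k (t k) * \prod_(f in nbS k) (a f (t f) * ((t k < t f)%N)%:R))).
  rewrite mulr_sumr -big_split /=; apply: eq_bigr => t _.
  by rewrite /g /tilt big_split /= -I_prod; ring.
rewrite (sum_star p_sum1 (fun=> 1) (fun f i j => ((i < j)%N)%:R) kN).
rewrite (sum_star p_sum1 (b k) (fun f i j => a f j * ((i < j)%N)%:R) kN).
congr (_ + _ * _); apply: eq_bigr => i _; rewrite ?mulr1; congr (_ * _).
  apply: eq_bigr => f _; rewrite [RHS]big_mkcond /=; apply: eq_bigr => j _.
  by case: ifP; rewrite ?mulr1 ?mulr0.
apply: eq_bigr => f _; rewrite [RHS]big_mkcond /=; apply: eq_bigr => j _.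
by case: ifP; rewrite ?mulr1 ?mulr0.
Qed.

End Law.

End LocalMinima.

(** * The bias and its gain *)

Section Waves.

Variables (R : realType) (n : nat).

(* Both waves have mean 0, and [wave_mid] is positive where the square of the
   tail sums of [wave_out] is large: their correlation is the gain. *)
Definition wave_out (j : nat) : R := if (j < 2 * n)%N then -1 else 1.
Definition wave_mid (j : nat) : R := if (n <= j < 3 * n)%N then 1 else -1.
(** The tail sums of [wave_out]: a tent with peak [2 * n] at slot [2 * n]. *)
Definition ramp (k : nat) : R :=
  if (k <= 2 * n)%N then k%:R else 4 * n%:R - k%:R.

Lemma sum_ord_gt (N i : nat) (F : nat -> R) :
  \sum_(j : 'I_N | (i < j)%N) F j = \sum_(i.+1 <= j < N) F j.
Proof.
rewrite -(big_mkord (fun j => i < j)%N F) (big_nat_widenl i.+1 0 N) //.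
Qed.

Lemma wave_out_tail (k : nat) : (k <= 4 * n)%N ->
  \sum_(k <= j < 4 * n) wave_out j = ramp k.
Proof.
move=> kn; rewrite (eq_big_nat _ _ (F2 := fun j => - ramp j.+1 - (- ramp j))).
  rewrite (telescope_sumr (fun j => - ramp j)) // /ramp.
  case: ifP; case: ifP => h1 h2; rewrite ?natrM; try lra.
  - have -> : n = 0%N by lia.
    have -> : k = 0%N by lia.
    by rewrite !mulr0; ring.
  - have -> : n = 0%N by lia.
    by lra.
move=> j /andP[_ jn]; rewrite /wave_out /ramp.
case: ltnP => h.
  by rewrite (ltnW h) -natr1; ring.
case: ifP => [h'|_]; last by rewrite -natr1; ring.
have -> : j = (2 * n)%N by lia.
by rewrite -natr1 natrM; ring.
Qed.

Lemma wave_out_after (i : nat) : (i < 4 * n)%N ->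
  \sum_(j : 'I_(4 * n) | (i < j)%N) wave_out j = ramp i.+1.
Proof. by move=> h; rewrite sum_ord_gt wave_out_tail. Qed.

Lemma wave_out_sum0 : \sum_(j < 4 * n) wave_out j = 0.
Proof. by rewrite -(big_mkord xpredT wave_out) wave_out_tail. Qed.

Lemma ramp_ge0 k : (k <= 4 * n)%N -> 0 <= ramp k.
Proof.
move=> h; rewrite /ramp; case: ifP => _ //.
by rewrite subr_ge0 -natrM ler_nat.
Qed.

(** Both waves are constant on each quarter of the slots, so sums are grouped by the position within
    a quarter. *)
Lemma sum_quarters (F : nat -> R) :
  \sum_(i < 4 * n) F i
  = \sum_(j < n) (F j + F (n + j)%N + F (2 * n + j)%N + F (3 * n + j)%N).
Proof.
rewrite -(big_mkord xpredT F) big_nat_mul /=.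
rewrite (eq_bigr (fun q => \sum_(j < n) F (q * n + j)%N)) => [|q _].
  rewrite !big_nat_recl // big_geq // addr0 -!big_split /=.
  by apply: eq_bigr => j _; rewrite mul0n add0n mul1n !addrA.
rewrite -{1}(add0n (q * n)%N) big_addn mulSn addnK big_mkord.
by apply: eq_bigr => j _; rewrite addnC.
Qed.

Lemma wave_mid_sum0 : \sum_(i < 4 * n) wave_mid i = 0.
Proof.
rewrite sum_quarters big1 // => j _; have jn := ltn_ord j.
rewrite /wave_mid ifF; last lia.
rewrite ifT; last lia.
rewrite ifT; last lia.
rewrite ifF; last lia.
by ring.
Qed.

(** With [k = j + 1], the four slots at position [j] contribute [- k^2 + (n + k)^2 + (2 n - k)^2 -
    (n - k)^2 = 4 n^2], whatever [k] is. *)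
Lemma wave_mid_ramp2 :
  \sum_(i < 4 * n) wave_mid i * ramp i.+1 ^+ 2 = 4 * n%:R ^+ 3.
Proof.
rewrite (sum_quarters (fun i => wave_mid i * ramp i.+1 ^+ 2)).
rewrite (eq_bigr (fun=> 4 * n%:R ^+ 2)) => [|j _].
  by rewrite sumr_const card_ord -mulr_natl; ring.
have jn := ltn_ord j.
rewrite /wave_mid /ramp.
rewrite ifF; last lia.
rewrite ifT; last lia.
rewrite ifT; last lia.
rewrite ifT; last lia.
rewrite ifT; last lia.
rewrite ifF; last lia.
rewrite ifF; last lia.
rewrite ifF; last lia.
have e q : (q * n + j).+1%:R = q%:R * n%:R + j%:R + 1 :> R.
  by rewrite -natr1 natrD natrM.
have := e 1%N; rewrite mul1n => ->; rewrite (e 2%N) (e 3%N) -[j.+1%:R]natr1.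
by move: (n%:R : R) (j%:R : R) => x y; ring.
Qed.

Lemma wave_out_le1 j : `|wave_out j| <= 1.
Proof. by rewrite /wave_out; case: ifP; rewrite ?normrN normr1. Qed.

Lemma wave_mid_le1 j : `|wave_mid j| <= 1.
Proof. by rewrite /wave_mid; case: ifP; rewrite ?normrN normr1. Qed.

End Waves.

(** * Winning probability of an edge and its monotonicity *)

Section Selection.

Variables (R : realType) (G : multigraph) (rho : vertex G -> nat) (n : nat).
Variables (p : edge G -> 'I_(4 * n) -> R) (m : edge G -> R).
Hypothesis p_gt0 : forall e i, 0 < p e i.
Hypothesis p_sum1 : forall e, \sum_i p e i = 1.
Hypothesis m_ge0 : forall e, 0 <= m e.
Hypothesis m_le : forall e i, m e <= p e i.

Local Notation edges := {set edge G}.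

Definition tail (f : edge G) (i : 'I_(4 * n)) : R :=
  \sum_(j : 'I_(4 * n) | (i < j)%N) p f j.

(** The gain from the tilt of [k] when [M] is its whole neighbourhood; the last factor is the
    correlation in [wave_mid_ramp2]. *)
Definition bonus (k : edge G) (M : edges) : R :=
  (central rho k M)%:R * (m k * (\prod_(f in M) m f) * (4 * n%:R ^+ 3)).

Definition first_prob (k : edge G) (M : edges) : R :=
  \sum_i p k i * (\prod_(f in M) tail f i) + bonus k M.

Lemma tail_ge0 f i : 0 <= tail f i.
Proof. by apply: sumr_ge0 => j _; apply: ltW. Qed.

Lemma tail_le1 f i : tail f i <= 1.
Proof.
rewrite -(p_sum1 f) /tail big_mkcond /=; apply: ler_sum => j _.
by case: ifP => // _; apply: ltW.
Qed.

Lemma bonus_ge0 k M : 0 <= bonus k M.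
Proof.
rewrite /bonus !mulr_ge0 ?ler0n ?exprn_ge0 //.
by apply: prodr_ge0.
Qed.

Lemma ramp_le_tail f (i : 'I_(4 * n)) : m f * ramp R n i.+1 <= tail f i.
Proof.
rewrite -wave_out_after // mulr_sumr; apply: ler_sum => j _.
apply: le_trans (m_le f j); rewrite ler_piMr //.
by have := wave_out_le1 R n j; rewrite ler_norml => /andP[].
Qed.

(** As [wave_out] has mean 0, [ramp] is also minus its sum over the slots up to [i], where
    [- m f * wave_out] is at most [p f]. *)
Lemma ramp_le_head f (i : 'I_(4 * n)) : m f * ramp R n i.+1 <= 1 - tail f i.
Proof.
have h : tail f i - 1 + m f * ramp R n i.+1
    = \sum_(j : 'I_(4 * n) | ~~ (i < j)%N) (- p f j - m f * wave_out R n j).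
  rewrite sumrB sumrN -mulr_sumr -(p_sum1 f) -wave_out_after //.
  have := wave_out_sum0 R n; rewrite (bigID (fun j : 'I_(4 * n) => (i < j)%N)) /=.
  move=> w0; rewrite (bigID (fun j : 'I_(4 * n) => (i < j)%N)) /= /tail.
  move/(canRL (addKr _)): w0 => ->; ring.
suff : tail f i - 1 + m f * ramp R n i.+1 <= 0 by lra.
rewrite h; apply: sumr_le0 => j _.
have := wave_out_le1 R n j; rewrite ler_norml => /andP[w _].
have := m_le f j; have := m_ge0 f; nra.
Qed.

Lemma ler_prod_tail (M' M : edges) i : M' \subset M ->
  \prod_(f in M) tail f i <= \prod_(f in M') tail f i.
Proof.
move=> sub; rewrite (big_setID M') /= (setIidPr sub).
rewrite ler_piMr //; first by apply: prodr_ge0 => f _; apply: tail_ge0.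
by apply: prodr_ile1 => f _; rewrite tail_ge0 tail_le1.
Qed.

(** Dropping neighbours increases the product of tails. The point is that the bonus, granted only to
    a full central pair, does not exceed what is gained by dropping one edge [g] of the pair. *)
Lemma first_prob_anti k (M' M : edges) : M' \subset M ->
  first_prob k M <= first_prob k M'.
Proof.
move=> sub.
have base : forall L : edges, M' \subset L ->
    \sum_i p k i * (\prod_(f in L) tail f i) <= first_prob k M'.
  move=> L sL; apply: (@le_trans _ _ (\sum_i p k i * (\prod_(f in M') tail f i))).
    by apply: ler_sum => i _; rewrite ler_pM2l ?ler_prod_tail.
  by rewrite lerDl bonus_ge0.
have [eqM|neM] := eqVneq M' M; first by rewrite eqM.
have [cM|ncM] := boolP (central rho k M); last first.
  by rewrite /first_prob /bonus (negbTE ncM) mul0r addr0 base.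
have [g gM gM'] : exists2 g, g \in M & g \notin M'.
  have /properP[_ [g gM gM']] : M' \proper M by rewrite properEneq neM.
  by exists g.
have c2 : #|M| = 2%N by case/and3P: cM => /eqP.
have /cards1P[f Mg] : #|M :\ g| == 1%N.
  by move: c2; rewrite (cardsD1 g) gM add1n => -[->].
have sub1 : M' \subset [set f].
  rewrite -Mg; apply/subsetP => x xM'; rewrite in_setD1 (subsetP sub) // andbT.
  by apply: contraNneq gM' => <-.
apply: le_trans (base _ sub1).
rewrite /first_prob /bonus cM mul1r -(wave_mid_ramp2 R n) mulr_sumr -big_split /=.
apply: ler_sum => i _; rewrite !(big_setD1 g gM) /= Mg !big_set1.
have h1 := ramp_le_tail f i; have h2 := ramp_le_head g i.
have h0 : 0 <= ramp R n i.+1 by apply: ramp_ge0.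
have hk : m k * wave_mid R n i <= p k i.
  apply: le_trans (m_le k i); rewrite ler_piMr //.
  by have := wave_mid_le1 R n i; rewrite ler_norml => /andP[].
have a0 : 0 <= m f * ramp R n i.+1 by rewrite mulr_ge0.
have b0 : 0 <= m g * ramp R n i.+1 by rewrite mulr_ge0.
(* The bonus is spread over the slots of [k]. In slot [i] its share is at most the probability that
   [k] rings there, [f] later and [g] not later, which is what dropping [g] adds. *)
have H : m k * wave_mid R n i * ((m f * ramp R n i.+1) * (m g * ramp R n i.+1))
    <= p k i * (tail f i * (1 - tail g i)).
  apply: (@le_trans _ _ (p k i * ((m f * ramp R n i.+1) * (m g * ramp R n i.+1)))).
    by rewrite ler_wpM2r // mulr_ge0.
  by rewrite ler_pM2l // ler_pM.
by move: H; lra.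
Qed.

(** Dividing by [p] turns the additive perturbation [m e * wave_out] of the slot masses into a
    relative one, bounded by 1 because [m e <= p e i]. *)
Definition wave_a (e : edge G) (i : 'I_(4 * n)) : R := m e * wave_out R n i / p e i.
Definition wave_b (e : edge G) (i : 'I_(4 * n)) : R := m e * wave_mid R n i / p e i.

Lemma p_wave_a e i : p e i * wave_a e i = m e * wave_out R n i.
Proof. by rewrite /wave_a mulrC divfK // gt_eqF. Qed.

Lemma p_wave_b e i : p e i * wave_b e i = m e * wave_mid R n i.
Proof. by rewrite /wave_b mulrC divfK // gt_eqF. Qed.

Lemma p_wave_a0 e : \sum_i p e i * wave_a e i = 0.
Proof. by under eq_bigr do rewrite p_wave_a; rewrite -mulr_sumr wave_out_sum0 mulr0. Qed.

Lemma p_wave_b0 e : \sum_i p e i * wave_b e i = 0.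
Proof. by under eq_bigr do rewrite p_wave_b; rewrite -mulr_sumr wave_mid_sum0 mulr0. Qed.

Lemma ratio_le1 e i (w : R) : `|w| <= 1 -> `|m e * w / p e i| <= 1.
Proof.
move=> w1; rewrite !normrM normfV (ger0_norm (m_ge0 e)) (gtr0_norm (p_gt0 e i)).
rewrite ler_pdivrMr // mul1r; apply: le_trans (m_le e i).
by rewrite ler_piMr.
Qed.

Lemma wave_a_le1 e i : `|wave_a e i| <= 1.
Proof. exact/ratio_le1/wave_out_le1. Qed.

Lemma wave_b_le1 e i : `|wave_b e i| <= 1.
Proof. exact/ratio_le1/wave_mid_le1. Qed.

Definition wave_law (S : edges) := clock_law rho S p wave_a wave_b.

Lemma wave_law_ge0 S t : 0 <= wave_law S t.
Proof.
by apply: clock_law_ge0 => *; rewrite ?wave_a_le1 ?wave_b_le1 ?ltW.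
Qed.

Lemma wave_law_sum1 S : \sum_t wave_law S t = 1.
Proof. by apply: clock_law_sum1 => *; rewrite ?p_wave_a0 ?p_wave_b0. Qed.

(** In the tilted term each of the two neighbours contributes [m f * ramp], so the square of [ramp]
    appears against [wave_mid]. *)
Lemma wave_law_first (S : edges) k : k \in S ->
  \sum_(t | first S t k) wave_law S t = first_prob k (S :&: nbr k).
Proof.
move=> kS; rewrite clock_law_first //; [|exact: p_wave_a0|exact: p_wave_b0].
rewrite /first_prob /bonus; congr (_ + _).
case: (boolP (central _ _ _)) => cM; last by rewrite !mul0r.
have c2 : #|S :&: nbr k| = 2%N by case/and3P: cM => /eqP.
rewrite !mul1r -(wave_mid_ramp2 R n) mulr_sumr; apply: eq_bigr => i _.
rewrite p_wave_b (eq_bigr (fun f => m f * ramp R n i.+1)) => [|f _].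
  by rewrite big_split /= prodr_const c2; ring.
under eq_bigr do rewrite p_wave_a.
by rewrite -mulr_sumr wave_out_after.
Qed.

End Selection.

(** * Geometric clocks and numerical bounds *)

Section GeometricClock.

Variables (R : realType) (N : nat).
Hypothesis N_gt0 : (0 < N)%N.

(** The chance that an exponential clock of rate [x] stays silent during one of the [N] slots of
    [0,1]. *)
Definition decay (x : R) : R := expR (- x / N%:R).
Definition decay_total (x : R) : R := \sum_(j < N) decay x ^+ j.
(** The slot in which such a clock first rings, conditioned on ringing before time 1. *)
Definition geo (x : R) (i : 'I_N) : R := decay x ^+ i / decay_total x.
Definition geo_min (x : R) : R := decay x ^+ N.-1 / decay_total x.
(* A Bernoulli variable of parameter [hit x <= x] stands for "a Poisson variable
   of parameter x is positive". *)
Definition hit (x : R) : R := 1 - expR (- x).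

Let NR0 : 0 < N%:R :> R. Proof. by rewrite ltr0n. Qed.

Lemma decay_gt0 x : 0 < decay x. Proof. exact: expR_gt0. Qed.

Lemma decay_le1 x : 0 <= x -> decay x <= 1.
Proof.
by move=> x0; rewrite -expR0 ler_expR mulNr oppr_le0 divr_ge0 // ltW.
Qed.

Lemma decayXN x : decay x ^+ N = expR (- x).
Proof. by rewrite -expRM_natr divfK // gt_eqF. Qed.

Lemma decay_total_gt0 x : 0 < decay_total x.
Proof.
rewrite /decay_total (bigD1 (Ordinal N_gt0)) //= ltr_wpDr ?exprn_gt0 ?decay_gt0 //.
by apply: sumr_ge0 => j _; apply/exprn_ge0/ltW/decay_gt0.
Qed.

Lemma geo_gt0 x i : 0 < geo x i.
Proof. by rewrite divr_gt0 ?decay_total_gt0 ?exprn_gt0 ?decay_gt0. Qed.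

Lemma geo_sum1 x : \sum_i geo x i = 1.
Proof. by rewrite -mulr_suml divff // gt_eqF ?decay_total_gt0. Qed.

Lemma geo_min_ge0 x : 0 <= geo_min x.
Proof. by rewrite ltW // divr_gt0 ?decay_total_gt0 ?exprn_gt0 ?decay_gt0. Qed.

Lemma geo_min_le x i : 0 <= x -> geo_min x <= geo x i.
Proof.
move=> x0; rewrite ler_pM2r ?invr_gt0 ?decay_total_gt0 //.
by apply: ler_wiXn2l; rewrite ?decay_le1 ?(ltW (decay_gt0 x)) // -ltnS prednK.
Qed.

Lemma hitE x : hit x = (1 - decay x) * decay_total x.
Proof.
have := subrX1 (decay x) N; rewrite decayXN => h.
by rewrite /hit -opprB h -mulNr opprB.
Qed.

Lemma hit_geo x i : hit x * geo x i = (1 - decay x) * decay x ^+ i.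
Proof.
rewrite hitE /geo; have := decay_total_gt0 x => h.
by field; rewrite gt_eqF.
Qed.

Lemma hit_ge0 x : 0 <= x -> 0 <= hit x.
Proof. by move=> x0; rewrite subr_ge0 -expR0 ler_expR oppr_le0. Qed.

Lemma hit_le x : hit x <= x.
Proof. by rewrite /hit; have := expR_ge1Dx (- x); lra. Qed.

Lemma hit_le1 x : hit x <= 1.
Proof. by rewrite /hit; have := expR_gt0 (- x); lra. Qed.

(* [1 - r >= r x / N] for [r = exp (- x / N)], because [1 / r >= 1 + x / N]. *)
Lemma decay_gap x : x / N%:R * decay x <= 1 - decay x.
Proof.
have h := expR_ge1Dx (x / N%:R).
have e : expR (x / N%:R) * decay x = 1 by rewrite /decay -expRD mulNr subrr expR0.
have := decay_gt0 x; move: h e; set r := decay x; set y := expR _; set z := x / _.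
by move=> h e r0; have : (1 + z) * r <= y * r; [rewrite ler_wpM2r // ltW | lra].
Qed.

(** With [r = decay x] the right side is [(1 - r) r^(N-1)]; apply [decay_gap] and
    [r^N = exp (- x)]. *)
Lemma hit_geo_min x : 0 <= x -> x / N%:R * expR (- x) <= hit x * geo_min x.
Proof.
move=> x0; have -> : hit x * geo_min x = (1 - decay x) * decay x ^+ N.-1.
  rewrite hitE /geo_min; have := decay_total_gt0 x => h.
  by field; rewrite gt_eqF.
have -> : expR (- x) = decay x * decay x ^+ N.-1 by rewrite -exprS prednK // decayXN.
rewrite mulrA ler_wpM2r ?decay_gap //.
by rewrite exprn_ge0 // ltW // decay_gt0.
Qed.

(** A neighbour leaves slot [i] to its rival if it is not sampled or rings later, that is, if the
    exponential clock is silent through slot [i]. The sum telescopes. *)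
Lemma miss_or_later x (i : 'I_N) :
  hit x * (\sum_(j : 'I_N | (i < j)%N) geo x j) + (1 - hit x) = decay x ^+ i.+1.
Proof.
rewrite mulr_sumr; under eq_bigr do rewrite hit_geo.
rewrite (sum_ord_gt N i (fun j => (1 - decay x) * decay x ^+ j)).
rewrite (eq_bigr (fun j => - decay x ^+ j.+1 - (- decay x ^+ j))) => [|j _]; last first.
  by rewrite exprS; ring.
rewrite (telescope_sumr (fun j => - decay x ^+ j)) ?ltn_ord // decayXN /hit.
by ring.
Qed.

Lemma decay_prod (I : finType) (P : pred I) (x : I -> R) :
  \prod_(f in P) decay (x f) = decay (\sum_(f in P) x f).
Proof.
rewrite /decay -sumrN mulr_suml expR_sum; apply: eq_bigr => f _.
by [].
Qed.

(* Up to [1 / N], a clock of rate [x] rings before an independent one of rate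
   [y] and before time 1 with probability x (1 - exp (- s)) / s, s = x + y. *)
Lemma race (x y : R) : 0 < x -> 0 <= y ->
  x * ((1 - expR (- (x + y))) / (x + y) - N%:R^-1)
  <= \sum_(i < N) (1 - decay x) * decay x ^+ i * decay y ^+ i.+1.
Proof.
move=> x0 y0; set s := x + y; have s0 : 0 < s by rewrite /s; lra.
have rE : decay s = decay x * decay y.
  by rewrite /decay -expRD -mulrDl opprD.
have -> : \sum_(i < N) (1 - decay x) * decay x ^+ i * decay y ^+ i.+1
    = (1 - decay x) * decay y * decay_total s.
  rewrite mulr_sumr; apply: eq_bigr => i _; rewrite rE exprMn exprS; ring.
have h1 := hitE s; have h2 := decay_gap x.
have T0 := decay_total_gt0 s; have y1 := decay_gt0 y.
have h3 : 1 - decay s <= s / N%:R.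
  by have := expR_ge1Dx (- s / N%:R); rewrite /decay mulNr; lra.
have h4 : 0 <= hit s by apply: hit_ge0; rewrite ltW.
have h5 := hit_le1 s.
rewrite -/(hit s).
have h6 : x / N%:R * decay s * decay_total s <= (1 - decay x) * decay y * decay_total s.
  by rewrite ler_pM2r // rE mulrA ler_pM2r.
apply: le_trans h6; rewrite -!mulrA ler_pM2l //.
have h7 : hit s <= s / N%:R * decay_total s by rewrite h1 ler_pM2r.
have h8 : hit s / s <= N%:R^-1 * decay_total s.
  by rewrite ler_pdivrMr // mulrC mulrA.
apply: (@le_trans _ _ (decay s * (hit s / s))); last first.
  by rewrite [X in _ <= X]mulrCA ler_pM2l // decay_gt0.
(* Replacing the factor [decay s] by 1 costs at most [1 / N], the error term of the statement. *)
have h9 : (1 - decay s) * (hit s / s) <= N%:R^-1.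
  apply: (@le_trans _ _ (s / N%:R * (hit s / s))).
    by rewrite ler_wpM2r // divr_ge0 // ltW.
  have -> : s / N%:R * (hit s / s) = hit s * N%:R^-1 by field; rewrite !gt_eqF.
  by rewrite ler_piMl // invr_ge0 ltW.
by move: h9; lra.
Qed.

End GeometricClock.

Section Numerics.

Variable R : realType.

(** Quantitative convexity: [exp] is compared with its chord over [0,2]. Divide by [exp d] and use
    [exp y >= (1 + y / 2)^2] at [y = - d] and [y = 2 - d]; the weighted squares add up to exactly
    [1 + d (2 - d) / 4]. *)
Lemma expR2_convex (d : R) : 0 <= d <= 2 ->
  expR d + d * (2 - d) / 4 <= (2 - d) / 2 + expR 2 * d / 2.
Proof.
move=> /andP[d0 d2].
have hd := expR_gt0 d.
have sq (y : R) : expR y = expR (y / 2) ^+ 2 by rewrite -expRM_natr; congr expR; field.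
have e2 : expR 2 = expR d * expR (2 - d) by rewrite -expRD; congr expR; ring.
have h1 : 1 + (2 - d) + (2 - d) ^+ 2 / 4 <= expR (2 - d).
  have h := expR_ge1Dx ((2 - d) / 2).
  have : (1 + (2 - d) / 2) ^+ 2 <= expR ((2 - d) / 2) ^+ 2 by rewrite ler_sqr ?nnegrE; lra.
  by rewrite -sq; lra.
have h2 : 1 - d + d ^+ 2 / 4 <= expR (- d).
  have h := expR_ge1Dx (- d / 2).
  have : (1 + - d / 2) ^+ 2 <= expR (- d / 2) ^+ 2 by rewrite ler_sqr ?nnegrE; lra.
  by rewrite -sq; lra.
have e1 : expR d * expR (- d) = 1 by rewrite -expRD subrr expR0.
have g1 : 1 <= expR d by have := expR_ge1Dx d; lra.
have k1 : expR d * ((2 - d) / 2 * (1 - d + d ^+ 2 / 4)) <= (2 - d) / 2.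
  have : expR d * ((2 - d) / 2 * (1 - d + d ^+ 2 / 4)) <= expR d * ((2 - d) / 2 * expR (- d)).
    by rewrite ler_pM2l // ler_wpM2l //; lra.
  by rewrite [expR d * (_ * expR _)]mulrCA e1 mulr1.
have k2 : expR d * (d / 2 * (1 + (2 - d) + (2 - d) ^+ 2 / 4)) <= expR 2 * d / 2.
  have : expR d * (d / 2 * (1 + (2 - d) + (2 - d) ^+ 2 / 4))
      <= expR d * (d / 2 * expR (2 - d)).
    by rewrite ler_pM2l // ler_wpM2l //; lra.
  by rewrite e2; lra.
have k3 : expR d + d * (2 - d) / 4 <= expR d * (1 + d * (2 - d) / 4).
  by have : 0 <= d * (2 - d) by [rewrite mulr_ge0; lra]; nra.
by apply: (le_trans k3); move: k1 k2; lra.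
Qed.

(** [(3 / 4)^8] is just above [1 / 10]. *)
Lemma expRN2_ge : 1 / 10 <= expR (- 2) :> R.
Proof.
have h := expR_ge1Dx (- 1 / 4 : R).
have -> : expR (- 2) = expR (- 1 / 4 : R) ^+ 8.
  by rewrite -expRM_natr; congr expR; field.
apply: (@le_trans _ _ ((1 + - 1 / 4) ^+ 8)); first by lra.
by apply: lerXn2r; rewrite ?nnegrE; lra.
Qed.

(** With [d = 2 - s] and [c = exp (- 2)], the basic scheme gains [c d / 4], more than the [c d / 64]
    by which the bonus may shrink. There remains [c / 192 >= 1 / 1920], which exceeds [4 / 10^4]. *)
Lemma race_bound (s P eps : R) : 0 < s <= 2 -> 0 <= P -> 1 / 2 - 3 / 2 * (2 - s) <= P ->
  eps <= 1 / 10 ^+ 4 ->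
  (1 - expR (- 2)) / 2 + 3 / 10 ^+ 4
  <= (1 - expR (- s)) / s - eps + expR (- s) / 96 * P.
Proof.
move=> /andP[s0 s2] P0 hP he; set d := 2 - s; set c := expR (- 2).
have d0 : 0 <= d by rewrite /d; lra.
have c1 : 1 / 10 <= c by exact: expRN2_ge.
have es : expR (- s) = c * expR d by rewrite -expRD; congr expR; rewrite /d; ring.
have ec : c * expR 2 = 1 by rewrite -expRD addrC subrr expR0.
have h := @expR2_convex d; have {h} := h _; rewrite d0 /= => h.
have {}h : expR d + d * (2 - d) / 4 <= (2 - d) / 2 + expR 2 * d / 2 by apply: h; rewrite /d; lra.
have h1 : c * expR d + c * (d * (2 - d) / 4) <= c * ((2 - d) / 2) + d / 2.
  have : c * (expR d + d * (2 - d) / 4) <= c * ((2 - d) / 2 + expR 2 * d / 2).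
    by rewrite ler_pM2l // expR_gt0.
  have : c * expR 2 * d = d by rewrite ec mul1r.
  by lra.
have h2 : (1 - c) / 2 + c * d / 4 <= (1 - expR (- s)) / s.
  rewrite ler_pdivlMr // es; have -> : s = 2 - d by rewrite /d; ring.
  by move: h1; lra.
have h3 : c / 96 * P <= expR (- s) / 96 * P.
  have hc : c <= expR (- s) by rewrite /c ler_expR lerN2.
  by rewrite ler_wpM2r //; lra.
have h4 : c / 96 * (1 / 2 - 3 / 2 * d) <= c / 96 * P.
  by rewrite ler_pM2l // divr_gt0 // expR_gt0.
have cd : 0 <= c * d by rewrite mulr_ge0 // expR_ge0.
by move: h2 h3 h4 c1 he; lra.
Qed.

End Numerics.

(** * Random rankings of four vertices *)

Section TopTwo.

Variable V : finType.

Definition top_two (rho : V -> nat) (a b c d : V) : bool :=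
  [&& (rho c < rho a)%N, (rho d < rho a)%N, (rho c < rho b)%N & (rho d < rho b)%N].

Definition rank_of (s : {perm V}) (v : V) : nat := enum_rank (s v).

Lemma rank_of_inj s : injective (rank_of s).
Proof. by move=> u v /val_inj/enum_rank_inj/perm_inj. Qed.

Lemma top_two_tperm s x y a b c d :
  top_two (rank_of (tperm x y * s)%g) a b c d
  = top_two (rank_of s) (tperm x y a) (tperm x y b) (tperm x y c) (tperm x y d).
Proof. by rewrite /top_two /rank_of !permM. Qed.

(** Every ranking puts one of the six pairs on top, and transpositions of vertices show that all six
    pairs are on top equally often. *)
Lemma card_top_two (a b c d : V) : uniq [:: a; b; c; d] ->
  (#|{perm V}| <= 6 * \sum_s top_two (rank_of s) a b c d)%N.
Proof.
rewrite /= !inE !negb_or => /and4P[/and3P[ab ac ad] /andP[bc bd] cd _].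
pose T a b c d := (\sum_s top_two (rank_of s) a b c d)%N.
have Tt x y a' b' c' d' : T a' b' c' d'
    = T (tperm x y a') (tperm x y b') (tperm x y c') (tperm x y d').
  rewrite /T (reindex_inj (mulgI (tperm x y))) /=.
  by apply: eq_bigr => s _; rewrite top_two_tperm.
have Tl a' b' c' d' : T a' b' c' d' = T b' a' c' d'.
  apply: eq_bigr => s _; rewrite /top_two.
  by do 2!case: (rank_of s c' < _)%N; do 2!case: (rank_of s d' < _)%N.
have Tr a' b' c' d' : T a' b' c' d' = T a' b' d' c'.
  apply: eq_bigr => s _; rewrite /top_two.
  by do 2!case: (rank_of s c' < _)%N; do 2!case: (rank_of s d' < _)%N.
have E1 : T a c b d = T a b c d.
  by rewrite (Tt b c) tpermL tpermR !tpermD // eq_sym.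
have E2 : T a d b c = T a b c d.
  by rewrite (Tt b d) tpermL tpermR !tpermD 1?Tr // eq_sym.
have E3 : T b c a d = T a b c d.
  by rewrite (Tt a c) tpermL tpermR !tpermD 1?Tl // eq_sym.
have E4 : T b d a c = T a b c d.
  by rewrite (Tt a d) tpermL tpermR !tpermD 1?Tl 1?Tr // eq_sym.
have E5 : T c d a b = T a b c d.
  by rewrite (Tt a c) tpermL tpermR !tpermD 1?Tr ?E2 // eq_sym.
have -> : (6 * T a b c d = T a b c d + T a c b d + T a d b c + T b c a d
    + T b d a c + T c d a b)%N by rewrite E1 E2 E3 E4 E5; lia.
rewrite -!big_split /= -sum1_card; apply: leq_sum => s _.
have inj := @rank_of_inj s.
have h x y : x != y -> (rank_of s x != rank_of s y)%N by rewrite (inj_eq inj).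
have := h _ _ ab; have := h _ _ ac; have := h _ _ ad.
have := h _ _ bc; have := h _ _ bd; have := h _ _ cd.
rewrite /top_two; move: (rank_of s a) (rank_of s b) (rank_of s c) (rank_of s d).
move=> x y z t {h inj E1 E2 E3 E4 E5 Tl Tr Tt ab ac ad bc bd cd T}.
case: (ltngtP z t) => // h1 _; case: (ltngtP y t) => // h2 _;
  case: (ltngtP y z) => // h3 _; case: (ltngtP x t) => // h4 _;
  case: (ltngtP x z) => // h5 _; case: (ltngtP x y) => // h6 _ //=; lia.
Qed.

End TopTwo.

(** * Degree bounds *)

Section ImageLaw.

Variables (R : realType) (W T : finType) (w : W -> R) (f : W -> T).
Hypothesis w_ge0 : forall o, 0 <= w o.
Hypothesis w_sum1 : \sum_o w o = 1.

Let image_mass : {ffun T -> R} := [ffun t => \sum_(o | f o == t) w o].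

Lemma image_mass_ge0 t : 0 <= image_mass t.
Proof. by rewrite ffunE; apply: sumr_ge0. Qed.

Lemma image_mass_sum1 : \sum_t image_mass t = 1.
Proof.
rewrite -w_sum1 (partition_big f xpredT) //=; apply: eq_bigr => t _.
by rewrite ffunE.
Qed.

Definition image_law : fdist R T := Fdist image_mass_ge0 image_mass_sum1.

Lemma Pr_image_law (Q : pred T) : Pr image_law Q = \sum_(o | Q (f o)) w o.
Proof.
rewrite /Pr [RHS](partition_big f Q) //=; apply: eq_bigr => t Qt.
rewrite ffunE; apply: eq_bigl => o; case: eqP => [->|_]; by rewrite ?Qt ?andbF.
Qed.

Lemma image_law_support t : image_law t != 0 -> exists2 o, f o = t & w o != 0.
Proof.
rewrite ffunE => nz; have [/exists_inP[o /eqP fo wo]|] := boolP [exists (o | f o == t), w o != 0].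
  by exists o.
rewrite negb_exists_in => /forall_inP h; rewrite big1 ?eqxx // in nz.
by move=> o fo; apply/eqP; have := h o fo; rewrite negbK.
Qed.

End ImageLaw.

(** * Degrees in the matching polytope *)

Section Degrees.

Variables (R : realType) (G : multigraph) (x : {ffun edge G -> R}).
Hypothesis x_in : scaled_polytope 1 (matchings G) x.

Lemma polytope_ge0 e : 0 <= x e.
Proof.
have [y [lam _ yE] xE] := x_in; rewrite xE mul1r yE.
by apply: sumr_ge0 => S _; rewrite mulr_ge0 ?mass_ge0 // ffunE ler0n.
Qed.

(** A matching has at most one edge at [v]; average over the convex combination. *)
Lemma degree_le1 v : \sum_(e | v \in ends e) x e <= 1.
Proof.
have [y [lam lam0 yE] xE] := x_in.
rewrite -(mass_sum1 lam); under eq_bigr do rewrite xE mul1r yE.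
rewrite exchange_big /=; apply: ler_sum => S _; rewrite -mulr_sumr.
have [SM|/lam0 ->] := boolP (S \in matchings G); last by rewrite mul0r.
rewrite ler_piMr ?mass_ge0 //.
under eq_bigr do rewrite ffunE; rewrite -natr_sum lern1.
have [/exists_inP[e ve eS]|] := boolP [exists (e | v \in ends e), e \in S].
  rewrite (bigD1 e) //= eS big1 // => f /andP[vf fe].
  apply/eqP; rewrite eqb0; apply: contra fe => fS; apply/eqP.
  apply: contraTeq vf => fe; have := matchings_disjoint SM fS eS fe.
  by move=> d; apply/negP => vf; rewrite (disjointFr d vf) in ve.
rewrite negb_exists_in => /forall_inP h; rewrite big1 // => f vf.
by apply/eqP; rewrite eqb0; apply: h.
Qed.

End Degrees.

(** * Disjoint edges at the two ends of an edge *)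

Section Crossing.

Variables (G : multigraph) (u v : vertex G).

Definition side (f : edge G) : bool := (u \in ends f) && (v \notin ends f).
Definition other_side (f : edge G) : bool := (v \in ends f) && (u \notin ends f).
Definition crossing (ff : edge G * edge G) : bool :=
  [&& side ff.1, other_side ff.2 & [disjoint ends ff.1 & ends ff.2]].

End Crossing.

Section CrossingSum.

Variables (R : realType) (G : multigraph) (x : {ffun edge G -> R}).
Hypothesis x_in : scaled_polytope 1 (matchings G) x.
Variables (u v : vertex G).
Hypothesis uv : u != v.

Lemma sum_far_ends (P : pred (edge G)) (w0 : vertex G) :
    (forall f, P f -> w0 \in ends f) ->
  \sum_(w | w != w0) \sum_(f | P f && (w \in ends f)) x f = \sum_(f | P f) x f.
Proof.
move=> Pw0; rewrite (exchange_big_dep P) /=; last by move=> w f _ /andP[].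
apply: eq_bigr => f Pf; rewrite Pf /=.
rewrite sumr_const (_ : #|_| = 1%N) //.
have := card_ends f; rewrite (cardsD1 w0) Pw0 // add1n => -[<-].
by apply: eq_card => w; rewrite !inE.
Qed.

(** Of the total [a * b], the pairs meeting at a common far end [w] are subtracted. They weigh at
    most [pw w * rw w <= (pw w + rw w) / 4], as [pw w + rw w <= 1], hence at most [(a + b) / 4] in
    all. *)
Lemma crossing_sum_ge :
  1 / 2 - 3 / 2 * (2 - \sum_(f | (u \in ends f) || (v \in ends f)) x f)
  <= \sum_(ff | crossing u v ff) x ff.1 * x ff.2.
Proof.
have x0 := polytope_ge0 x_in.
set a := \sum_(f | side u v f) x f.
set b := \sum_(f | other_side u v f) x f.
set q := \sum_(f | (u \in ends f) && (v \in ends f)) x f.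
have au : a + q <= 1.
  rewrite addrC; apply: le_trans (degree_le1 x_in u).
  by rewrite (bigID (fun f => v \in ends f)).
have bv : b + q <= 1.
  rewrite addrC; apply: le_trans (degree_le1 x_in v).
  rewrite (bigID (fun f => u \in ends f)) /= /q /b.
  by under eq_bigl do rewrite andbC.
have -> : \sum_(f | (u \in ends f) || (v \in ends f)) x f = a + b + q.
  rewrite /a /b /q !(big_mkcond _ x) -!big_split /=; apply: eq_bigr => f _.
  by rewrite /side /other_side; do 2!case: (_ \in _); rewrite /= ?addr0 ?add0r.
have [a0 b0 q0] : [/\ 0 <= a, 0 <= b & 0 <= q] by split; apply: sumr_ge0.
pose pw w := \sum_(f | side u v f && (w \in ends f)) x f.
pose rw w := \sum_(f | other_side u v f && (w \in ends f)) x f.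
have meet : a * b - \sum_(w | (w != u) && (w != v)) pw w * rw w
    <= \sum_(ff | crossing u v ff) x ff.1 * x ff.2.
  have -> : a * b = \sum_(ff : edge G * edge G | side u v ff.1 && other_side u v ff.2)
      x ff.1 * x ff.2 by rewrite /a /b big_distrlr pair_big.
  rewrite (bigID (fun ff => [disjoint ends ff.1 & ends ff.2])) /=.
  under eq_bigl do rewrite -andbA.
  rewrite lerBlDr lerD2l.
  have -> : \sum_(w | (w != u) && (w != v)) pw w * rw w
      = \sum_(ff : edge G * edge G | side u v ff.1 && other_side u v ff.2)
          \sum_(w | [&& w != u, w != v, w \in ends ff.1 & w \in ends ff.2])
          x ff.1 * x ff.2.
    rewrite (exchange_big_dep (fun w => (w != u) && (w != v))) /=; last first.
      by move=> ff w _ /and4P[-> ->].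
    apply: eq_bigr => w /andP[wu wv]; rewrite /pw /rw big_distrlr pair_big /=.
    by apply: eq_bigl => ff; rewrite wu wv /= andbACA.
  rewrite [X in _ <= X](bigID (fun ff => [disjoint ends ff.1 & ends ff.2])) /=.
  rewrite ler_wpDl //.
    by apply: sumr_ge0 => ff _; apply: sumr_ge0 => w _; rewrite mulr_ge0.
  apply: ler_sum => ff /andP[/andP[/andP[_ vf] /andP[_ uf]] /not_disjointP[w w1 w2]].
  rewrite (bigD1 w) /=; last first.
    by rewrite w1 w2 !andbT; apply/andP; split; [apply: contraNneq uf => <- |
      apply: contraNneq vf => <-].
  by rewrite lerDl; apply: sumr_ge0 => w' _; rewrite mulr_ge0.
have pr w : (w != u) && (w != v) -> pw w * rw w <= (pw w + rw w) / 4.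
  move=> /andP[wu wv].
  have p0 : 0 <= pw w by apply: sumr_ge0.
  have r0 : 0 <= rw w by apply: sumr_ge0.
  have pr1 : pw w + rw w <= 1.
    apply: le_trans (degree_le1 x_in w).
    rewrite /pw /rw !(big_mkcond _ x) -big_split /=; apply: ler_sum => f _.
    rewrite /side /other_side; have := x0 f.
    by do 3!case: (_ \in _); rewrite /= ?addr0 ?add0r.
  have := sqr_ge0 (pw w - rw w); nra.
have sa : \sum_(w | (w != u) && (w != v)) pw w <= a.
  rewrite /a -(@sum_far_ends _ u) => [|f /andP[]//].
  rewrite [X in _ <= X](bigID (fun w => w != v)) lerDl.
  by apply: sumr_ge0 => w _; apply: sumr_ge0.
have sb : \sum_(w | (w != u) && (w != v)) rw w <= b.
  rewrite /b -(@sum_far_ends _ v) => [|f /andP[]//].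
  rewrite [X in _ <= X](bigID (fun w => w != u)) /=.
  under [X in _ <= X + _]eq_bigl do rewrite andbC.
  by rewrite lerDl; apply: sumr_ge0 => w _; apply: sumr_ge0.
have sab : \sum_(w | (w != u) && (w != v)) pw w * rw w <= (a + b) / 4.
  apply: le_trans (ler_sum _ pr) _; rewrite -mulr_suml big_split /=.
  by lra.
(* This gives [a b >= a + b - 1]; the average of [a + q <= 1] and [b + q <= 1] does the rest. *)
have : 0 <= (1 - a) * (1 - b) by apply: mulr_ge0; lra.
by lra.
Qed.

End CrossingSum.

(** * The scheme *)

Section Scheme.

Variables (R : realType) (G : multigraph) (n : nat).
Hypothesis n_gt0 : (0 < n)%N.

Let N_gt0 : (0 < 4 * n)%N. Proof. by rewrite muln_gt0. Qed.

Local Notation edges := {set edge G}.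
Local Notation perms := {perm vertex G}.

(* Selectors are total, so everything is expressed with [`|x e|], which is [x e]
   on the polytope. At [x e = 0] the quotient in [thinning] is 0. *)
Definition thinning (x : {ffun edge G -> R}) (e : edge G) : R := hit `|x e| / `|x e|.
Definition clock (x : {ffun edge G -> R}) (e : edge G) (i : 'I_(4 * n)) : R :=
  geo `|x e| i.
Definition clock_min (x : {ffun edge G -> R}) (e : edge G) : R := geo_min (4 * n) `|x e|.

Lemma thinning_bounds x e : 0 <= thinning x e <= 1.
Proof.
rewrite /thinning divr_ge0 ?hit_ge0 //=.
have [->|x0] := eqVneq (x e) 0; first by rewrite normr0 invr0 mulr0 ler01.
by rewrite ler_pdivrMr ?normr_gt0 // mul1r hit_le.
Qed.

Lemma thinningE (x : {ffun edge G -> R}) e : 0 <= x e -> x e * thinning x e = hit (x e).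
Proof.
move=> x0; rewrite /thinning ger0_norm //.
have [->|nz] := eqVneq (x e) 0; first by rewrite /hit oppr0 expR0 subrr mul0r.
by rewrite mulrC divfK.
Qed.

Lemma masked_bounds x (A : edges) e : 0 <= masked (thinning x) A e <= 1.
Proof.
rewrite ffunE; case: (e \in A); last by rewrite mul0r lexx ler01.
by rewrite mul1r thinning_bounds.
Qed.

Let clock_gt0 x e i : 0 < clock x e i. Proof. exact: geo_gt0. Qed.
Let clock_sum1 x e : \sum_i clock x e i = 1. Proof. exact: geo_sum1. Qed.
Let clock_min_ge0 x e : 0 <= clock_min x e. Proof. exact: geo_min_ge0. Qed.
Let clock_min_le x e i : clock_min x e <= clock x e i. Proof. exact: geo_min_le. Qed.

Local Notation outcome := (perms * edges * {ffun edge G -> 'I_(4 * n)})%type.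

(** Joint law of a uniform ranking, the thinned set, and the clocks, whose law depends on the other
    two. *)
Definition weight (x : {ffun edge G -> R}) (A : edges) (o : outcome) : R :=
  #|[set: perms]|%:R^-1 * (Pr_rset (masked (thinning x) A) o.1.2
    * wave_law (rank_of o.1.1) (clock x) (clock_min x) o.1.2 o.2).

Lemma weight_ge0 x A o : 0 <= weight x A o.
Proof.
rewrite mulr_ge0 ?invr_ge0 ?ler0n // mulr_ge0 //; last exact: wave_law_ge0.
by apply: Pr_rset_ge0 => e; apply: masked_bounds.
Qed.

Lemma perms_gt0 : 0 < #|[set: perms]|%:R :> R.
Proof. by rewrite ltr0n cardG_gt0. Qed.

Lemma sum_weight x A (Q : edges -> {ffun edge G -> 'I_(4 * n)} -> bool) :
  \sum_(o : outcome | Q o.1.2 o.2) weight x A o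
  = #|[set: perms]|%:R^-1 * \sum_(s : perms) \sum_(S : edges)
      Pr_rset (masked (thinning x) A) S
      * \sum_(t | Q S t) wave_law (rank_of s) (clock x) (clock_min x) S t.
Proof.
under [in RHS]eq_bigr => s _ do under eq_bigr => S _ do rewrite mulr_sumr.
rewrite pair_big /= pair_big_dep /= mulr_sumr.
by apply: eq_bigr => -[[s S] t].
Qed.

Lemma weight_sum1 x A : \sum_o weight x A o = 1.
Proof.
rewrite (sum_weight x A (fun _ _ => true)).
under eq_bigr => s _.
  under eq_bigr => S _ do rewrite wave_law_sum1 // mulr1.
  rewrite sum_Pr_rset1; over.
by rewrite sumr_const -cardsT mulVf // gt_eqF ?perms_gt0.
Qed.

Definition race_scheme : selector R (edge G) := fun x A =>
  image_law (fun o : outcome => local_minima o.1.2 o.2)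
    (weight_ge0 x A) (weight_sum1 x A).

Definition win_prob (x : {ffun edge G -> R}) (e : edge G) (S : edges) (s : perms) : R :=
  (e \in S)%:R * first_prob (rank_of s) (clock x) (clock_min x) e (S :&: nbr e).

Lemma Pr_race x A e :
  Pr (race_scheme x A) [pred S : edges | e \in S]
  = #|[set: perms]|%:R^-1 * \sum_(s : perms) \sum_(S : edges)
      Pr_rset (masked (thinning x) A) S * win_prob x e S s.
Proof.
rewrite Pr_image_law (sum_weight x A (fun S t => e \in local_minima S t)).
congr (_ * _); apply: eq_bigr => s _; apply: eq_bigr => S _; congr (_ * _).
rewrite /win_prob; case: (boolP (e \in S)) => eS; last first.
  by rewrite mul0r big1 // => t; rewrite inE (negbTE eS).
rewrite mul1r -wave_law_first //; apply: eq_bigl => t.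
by rewrite inE eS.
Qed.

Lemma race_scheme_valid x (A S : edges) :
  race_scheme x A S != 0 -> (S \subset A) && (S \in matchings G).
Proof.
move/image_law_support => [[[s T] t] /= <- nz].
rewrite local_minima_matching andbT.
have : Pr_rset (masked (thinning x) A) T != 0.
  by apply: contraNneq nz; rewrite /weight /= => ->; rewrite mul0r mulr0.
move=> nz'; apply/subsetP => e; rewrite inE => /andP[eT _].
apply: contraNT nz' => eA; apply/prodf_eq0; exists e => //.
by rewrite eT ffunE (negbTE eA) mul0r.
Qed.

(** Couple the two thinnings by [sum_Pr_rset_restrict]; for each ranking and each sample, the
    smaller instance leaves [e] fewer rivals. *)
Lemma race_scheme_monotone x (e : edge G) (A B : edges) :
    e \in A -> A \subset B ->
  Pr (race_scheme x B) [pred S : edges | e \in S]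
  <= Pr (race_scheme x A) [pred S : edges | e \in S].
Proof.
move=> eA AB; rewrite !Pr_race ler_pM2l ?invr_gt0 ?perms_gt0 //.
apply: ler_sum => s _; rewrite -(sum_Pr_rset_restrict _ (win_prob x e ^~ s) AB).
apply: ler_sum => S _; apply: ler_wpM2l.
  by apply: Pr_rset_ge0 => f; apply: masked_bounds.
rewrite /win_prob inE eA andbT ler_wpM2l //; apply: first_prob_anti => //.
by apply: setSI; apply: subsetIl.
Qed.

Lemma Pr_selected_race (x : {ffun edge G -> R}) e : (forall f, 0 <= x f) ->
  Pr_selected race_scheme x e
  = #|[set: perms]|%:R^-1 * \sum_(s : perms) \sum_(S : edges)
      Pr_rset [ffun f => hit (x f)] S * win_prob x e S s.
Proof.
move=> x0; rewrite /Pr_selected.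
under eq_bigr => A _ do rewrite Pr_race mulrCA mulr_sumr.
rewrite -mulr_sumr exchange_big /=; congr (_ * _); apply: eq_bigr => s _.
under eq_bigr => A _ do rewrite mulr_sumr.
rewrite exchange_big /=; apply: eq_bigr => S _.
under eq_bigr => A _ do rewrite mulrA.
rewrite -mulr_suml sum_Pr_rset_masked; congr (Pr_rset _ S * _).
by apply/ffunP => f; rewrite !ffunE thinningE.
Qed.

(** * Balancedness *)

Section Balance.

Variables (x : {ffun edge G -> R}) (e : edge G).
Hypothesis x_in : scaled_polytope 1 (matchings G) x.

Let x_ge0 := polytope_ge0 x_in.
Let z : {ffun edge G -> R} := [ffun f => hit (x f)].

Lemma sum_nbr_factor (c d : edge G -> R) :
  \sum_(S : edges) Pr_rset z S * ((e \in S)%:R *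
     \prod_(f in nbr e) (if f \in S then c f else d f))
  = z e * \prod_(f in nbr e) (z f * c f + (1 - z f) * d f).
Proof.
(* The edge [e] carries the indicator of being sampled; edges outside its star carry 1. *)
pose a f := if f == e then 1 else if f \in nbr e then c f else 1.
pose b f := if f == e then 0 else if f \in nbr e then d f else 1.
have eN : e \notin nbr e by rewrite inE adjxx.
transitivity (\sum_(S : edges) Pr_rset z S * \prod_f (if f \in S then a f else b f)).
  apply: eq_bigr => S _; congr (_ * _).
  rewrite [RHS](bigD1 e) //= {1}/a {1}/b eqxx; congr (_ * _); first by case: (e \in S).
  rewrite big_mkcond /= [LHS](bigD1 e) //= (negbTE eN) mul1r; apply: eq_bigr => f fe.
  by rewrite /a /b (negbTE fe); case: (f \in nbr e); case: (f \in S).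
rewrite sum_Pr_rset (bigD1 e) //= /a /b eqxx mulr1 mulr0 addr0; congr (_ * _).
rewrite [RHS]big_mkcond /= [RHS](bigD1 e) //= (negbTE eN) mul1r; apply: eq_bigr => f fe.
by rewrite (negbTE fe); case: (f \in nbr e) => //; ring.
Qed.

Lemma prod_nbrI (S : edges) (F : edge G -> R) :
  \prod_(f in S :&: nbr e) F f = \prod_(f in nbr e) (if f \in S then F f else 1).
Proof.
by rewrite -big_mkcondr /=; apply: eq_bigl => f; rewrite inE andbC.
Qed.

Let xE f : `|x f| = x f. Proof. by rewrite ger0_norm. Qed.

(** Given the slot of [e], each neighbour is independently missing or later. By [miss_or_later] and
    [decay_prod] the neighbours act as one clock of their total rate. *)
Lemma base_prob :
  \sum_(S : edges) Pr_rset z S * ((e \in S)%:R *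
     \sum_i clock x e i * (\prod_(f in S :&: nbr e) tail (clock x) f i))
  = \sum_(i < 4 * n) (1 - decay (4 * n) (x e)) * decay (4 * n) (x e) ^+ i
     * decay (4 * n) (\sum_(f in nbr e) x f) ^+ i.+1.
Proof.
under eq_bigr => S _ do rewrite mulr_sumr mulr_sumr.
rewrite exchange_big /=; apply: eq_bigr => i _.
rewrite -hit_geo // -decay_prod -prodrXl.
transitivity (clock x e i * \sum_(S : edges) Pr_rset z S * ((e \in S)%:R *
     \prod_(f in nbr e) (if f \in S then tail (clock x) f i else 1))).
  rewrite mulr_sumr; apply: eq_bigr => S _; rewrite prod_nbrI; ring.
rewrite sum_nbr_factor mulrA [clock x e i * _]mulrC ffunE /clock xE; congr (_ * _).
apply: eq_bigr => f _; rewrite ffunE -miss_or_later // mulr1; congr (_ * _ + _).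
by apply: eq_bigr => j _; rewrite xE.
Qed.


Variables u v : vertex G.
Hypothesis uv : u != v.
Hypothesis e_ends : ends e = [set u; v].

Lemma crossing_nbr ff : crossing u v ff ->
  [/\ ff.1 \in nbr e, ff.2 \in nbr e & ff.1 != ff.2].
Proof.
case: ff => f1 f2 /and3P[/andP[/= u1 v1] /andP[v2 u2] _].
have h f w w' : w \in [set u; v] -> w' \in [set u; v] -> w \in ends f -> w' \notin ends f ->
    f \in nbr e.
  move=> we w'e wf w'f; rewrite inE /adj; apply/andP; split.
    by apply: contraNneq w'f => <-; rewrite e_ends.
  by apply/negP => d; rewrite (disjointFr d) // e_ends in wf.
split; first by apply: (h _ u v); rewrite ?inE ?eqxx ?orbT.
  by apply: (h _ v u); rewrite ?inE ?eqxx ?orbT.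
by apply: contraTneq u1 => ->.
Qed.

Lemma far_end (f : edge G) a : a \in ends f -> exists2 w, w != a & ends f = [set a; w].
Proof.
move=> af; have : #|ends f :\ a| == 1%N.
  by have := card_ends f; rewrite (cardsD1 a) af add1n => -[->].
move/cards1P => [w Ew]; exists w; last by rewrite -Ew setD1K.
by have := set11 w; rewrite -Ew in_setD1 => /andP[].
Qed.

(** Since [f1] and [f2] are disjoint, [u], [v] and the far ends [w1], [w2] are four distinct
    vertices, and [e] is central as soon as [u], [v] are the top two. *)
Lemma mean_central_ge f1 f2 : crossing u v (f1, f2) ->
  1 / 6 <= #|[set: perms]|%:R^-1
           * \sum_(s : perms) (central (rank_of s) e [set f1; f2])%:R :> R.
Proof.
move=> cr; have [_ _ /= f12] := crossing_nbr cr.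
case/and3P: cr => /andP[/= u1 v1] /andP[v2 u2] dj.
have [w1 w1u E1] := far_end u1; have [w2 w2v E2] := far_end v2.
have w1v : w1 != v by apply: contraNneq v1 => <-; rewrite E1 !inE eqxx orbT.
have w2u : w2 != u by apply: contraNneq u2 => <-; rewrite E2 !inE eqxx orbT.
have w12 : w1 != w2.
  apply/eqP => w12; have w1f : w1 \in ends f1 by rewrite E1 !inE eqxx orbT.
  by move: (disjointFr dj w1f); rewrite E2 w12 !inE eqxx orbT.
have cen (s : perms) : (top_two (rank_of s) u v w1 w2 <= central (rank_of s) e [set f1; f2])%N.
  case: (boolP (top_two _ _ _ _ _)) => // /and4P[ua ub va vb].
  rewrite lt0b; apply/and3P; split; first by rewrite cards2 f12.
    rewrite inE; apply/forallP => g; apply/implyP; rewrite !inE => hg.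
    apply/forallP => h; apply/implyP; rewrite !inE => hh; apply/implyP.
    case/orP: hg => /eqP ->; case/orP: hh => /eqP ->; rewrite ?eqxx //.
    by rewrite disjoint_sym.
  apply/forall_inP => a; rewrite e_ends !inE => ha.
  apply/forall_inP => g; rewrite !inE => hg; apply/forall_inP => b.
  rewrite !inE negb_or => /andP[/andP[bu bv]].
  case/orP: hg => /eqP ->; rewrite ?E1 ?E2 !inE ?(negbTE bu) ?(negbTE bv) /= => /eqP ->;
    by case/orP: ha => /eqP ->.
have un : uniq [:: u; v; w1; w2].
  by rewrite /= !inE !negb_or uv w12 ![u == _]eq_sym ![v == _]eq_sym w1u w2u w1v w2v.
have := card_top_two un; rewrite -[#|_|]cardsT => hc.
have : (#|[set: perms]| <= 6 * \sum_s central (rank_of s) e [set f1; f2])%N.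
  by apply: leq_trans hc _; rewrite leq_mul2l; apply: leq_sum => s _; apply: cen.
rewrite -(ler_nat R) natrM natr_sum => h.
by rewrite [X in _ <= X]mulrC ler_pdivlMr ?perms_gt0 // mul1r mulrC ler_pdivrMr // [X in _ <= X]mulrC.
Qed.

Let bonus_size (M : edges) : R :=
  clock_min x e * (\prod_(f in M) clock_min x f) * (4 * n%:R ^+ 3).

Let bonus_size_ge0 M : 0 <= bonus_size M.
Proof.
apply: mulr_ge0; last by rewrite !mulr_ge0 ?exprn_ge0 ?invr_ge0 ?ler0n.
by apply: mulr_ge0; rewrite ?clock_min_ge0 //; apply: prodr_ge0 => f _; apply: clock_min_ge0.
Qed.

Lemma mean_bonus_ge (M : edges) :
  \sum_(ff | crossing u v ff) (M == [set ff.1; ff.2])%:R * (bonus_size M / 6)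
  <= #|[set: perms]|%:R^-1 * \sum_(s : perms) bonus (rank_of s) n (clock_min x) e M.
Proof.
have -> : \sum_(s : perms) bonus (rank_of s) n (clock_min x) e M
    = (\sum_(s : perms) (central (rank_of s) e M)%:R) * bonus_size M.
  by rewrite mulr_suml.
have [/exists_inP[[f1 f2] cr /eqP ME]|] :=
    boolP [exists (ff | crossing u v ff), M == [set ff.1; ff.2]]; last first.
  rewrite negb_exists_in => /forall_inP h; rewrite big1.
    apply: mulr_ge0; first by rewrite invr_ge0 ler0n.
    by apply: mulr_ge0 => //; apply: sumr_ge0 => s _; apply: ler0n.
  by move=> ff cr; rewrite (negbTE (h _ cr)) mul0r.
rewrite (bigD1 (f1, f2)) //= -ME eqxx mul1r big1 ?addr0; last first.
  (* The set [M] determines the ordered pair: only its first edge contains [u]. Hence at most one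
     summand is nonzero. *)
  move=> [g1 g2] /andP[cr' ne]; case: eqP => [E|]; last by rewrite mul0r.
  case/negP: ne; apply/eqP.
  case/and3P: cr => /andP[/= u1 v1] /andP[v2 u2] _.
  case/and3P: cr' => /andP[/= u1' v1'] /andP[v2' u2'] _.
  have g1M : g1 \in [set f1; f2] by rewrite -ME E !inE eqxx.
  have g2M : g2 \in [set f1; f2] by rewrite -ME E !inE eqxx orbT.
  congr pair; [move: g1M|move: g2M]; rewrite !inE => /orP[] /eqP // E'.
    by rewrite E' (negbTE u2) in u1'.
  by rewrite E' (negbTE v1) in v2'.
have -> : bonus_size M / 6 = 1 / 6 * bonus_size M by rewrite mul1r mulrC.
by rewrite [X in _ <= X]mulrA ler_wpM2r //; have := mean_central_ge cr; rewrite -ME.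
Qed.

(** The neighbours sampled are exactly [ff.1], [ff.2] with a product probability. Each of the three
    edges gives [hit * clock_min >= x / (4 n) * exp (- x)] and each other neighbour [exp (- x)]. The
    constant is [4 n^3 / 6 / (4 n)^3 = 1 / 96]. *)
Lemma crossing_term ff : crossing u v ff ->
  x e * (expR (- (x e + \sum_(f in nbr e) x f)) / 96) * (x ff.1 * x ff.2)
  <= \sum_(S : edges) Pr_rset z S * ((e \in S)%:R *
       ((S :&: nbr e == [set ff.1; ff.2])%:R * (bonus_size [set ff.1; ff.2] / 6))).
Proof.
move=> cr; have [f1N f2N f12] := crossing_nbr cr.
set M := [set ff.1; ff.2].
have MN : M \subset nbr e by rewrite subUset !sub1set f1N.
have ME (F : edge G -> R) : \prod_(f in nbr e) (if f \in M then F f else 1) = F ff.1 * F ff.2.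
  have eM : \prod_(f in M) F f = F ff.1 * F ff.2.
    by rewrite /M big_setU1 ?inE //= big_set1.
  rewrite -eM -big_mkcondr /=; apply: eq_bigl => f.
  by case fM: (f \in M); rewrite ?andbF // (subsetP MN).
have -> : \sum_(S : edges) Pr_rset z S * ((e \in S)%:R *
       ((S :&: nbr e == M)%:R * (bonus_size M / 6)))
    = bonus_size M / 6 * (z e * \prod_(f in nbr e) (if f \in M then z f else 1 - z f)).
  transitivity (bonus_size M / 6 * \sum_(S : edges) Pr_rset z S * ((e \in S)%:R *
     \prod_(f in nbr e) (if f \in S then (f \in M)%:R else (f \notin M)%:R))).
    rewrite mulr_sumr; apply: eq_bigr => S _.
    have -> : (S :&: nbr e == M) = [forall f in nbr e, (f \in S) == (f \in M)].
      apply/eqP/forall_inP => [<- f fN|h]; first by rewrite inE fN andbT.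
      apply/setP => f; rewrite inE; case fN: (f \in nbr e).
        by rewrite andbT; apply/eqP/h.
      by rewrite andbF; apply/esym/negbTE; apply: contraFN fN; apply/subsetP.
    rewrite natr_forall.
    have -> : \prod_(f in nbr e) ((f \in S) == (f \in M))%:R =
        \prod_(f in nbr e) (if f \in S then (f \in M)%:R else (f \notin M)%:R) :> R.
      by apply: eq_bigr => f _; case: (f \in S); case: (f \in M).
    by ring.
  rewrite sum_nbr_factor; congr (_ * (_ * _)); apply: eq_bigr => f _.
  by case: (f \in M); rewrite /=; ring.
have -> : bonus_size M / 6 * (z e * \prod_(f in nbr e) (if f \in M then z f else 1 - z f))
    = 2 / 3 * n%:R ^+ 3 * (hit (x e) * clock_min x e) *
      \prod_(f in nbr e) (if f \in M then hit (x f) * clock_min x f else expR (- x f)).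
  have -> : \prod_(f in nbr e) (if f \in M then hit (x f) * clock_min x f else expR (- x f))
      = (\prod_(f in nbr e) (if f \in M then clock_min x f else 1))
        * \prod_(f in nbr e) (if f \in M then z f else 1 - z f).
    rewrite -big_split /=; apply: eq_bigr => f _; rewrite !ffunE /hit.
    by case: (f \in M); ring.
  have -> : \prod_(f in nbr e) (if f \in M then clock_min x f else 1)
      = \prod_(f in M) clock_min x f.
    rewrite -big_mkcondr /=; apply: eq_bigl => f.
    by case fM: (f \in M); rewrite ?andbF // (subsetP MN).
  rewrite /bonus_size ffunE.
  set P1 := \prod_(f in M) _; set P2 := \prod_(f in nbr e) _.
  by field.
have nR : n%:R != 0 :> R by rewrite pnatr_eq0 -lt0n.
have -> : x e * (expR (- (x e + \sum_(f in nbr e) x f)) / 96) * (x ff.1 * x ff.2)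
    = 2 / 3 * n%:R ^+ 3 * (x e / (4 * n)%:R * expR (- x e)) *
      \prod_(f in nbr e) (if f \in M then x f / (4 * n)%:R * expR (- x f) else expR (- x f)).
  have -> : \prod_(f in nbr e) (if f \in M then x f / (4 * n)%:R * expR (- x f) else expR (- x f))
      = (\prod_(f in nbr e) (if f \in M then x f / (4 * n)%:R else 1))
        * expR (- \sum_(f in nbr e) x f).
    rewrite -sumrN expR_sum -big_split /=; apply: eq_bigr => f _.
    by case: (f \in M); rewrite ?mul1r.
  rewrite ME opprD expRD natrM.
  by field.
have hb f : 0 <= x f / (4 * n)%:R * expR (- x f) <= hit (x f) * clock_min x f.
  rewrite /clock_min xE hit_geo_min // andbT mulr_ge0 ?expR_ge0 //.
  by rewrite divr_ge0.
have /andP[he0 he1] := hb e.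
have c0 : 0 <= 2 / 3 * n%:R ^+ 3 :> R by rewrite !mulr_ge0 ?exprn_ge0 ?invr_ge0 ?ler0n.
apply: ler_pM => //; first by rewrite mulr_ge0.
- by apply: prodr_ge0 => f _; case: ifP => _; [case/andP: (hb f) | exact: expR_ge0].
- by rewrite ler_wpM2l.
by apply: ler_prod => f _; case: ifP => _; rewrite ?hb ?expR_ge0 ?lexx.
Qed.

Lemma Pr_selected_race_ge :
  \sum_(i < 4 * n) (1 - decay (4 * n) (x e)) * decay (4 * n) (x e) ^+ i
     * decay (4 * n) (\sum_(f in nbr e) x f) ^+ i.+1
  + x e * (expR (- (x e + \sum_(f in nbr e) x f)) / 96
           * \sum_(ff | crossing u v ff) x ff.1 * x ff.2)
  <= Pr_selected race_scheme x e.
Proof.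
rewrite Pr_selected_race // [X in _ <= _ * X]exchange_big /= [X in _ <= X]mulr_sumr.
pose c : R := #|[set: perms]|%:R^-1.
have cP : c * #|[set: perms]|%:R = 1 by rewrite mulVf // gt_eqF ?perms_gt0.
have -> : \sum_(S : edges) c * (\sum_(s : perms) Pr_rset z S * win_prob x e S s)
    = \sum_(S : edges) Pr_rset z S * ((e \in S)%:R *
     \sum_i clock x e i * (\prod_(f in S :&: nbr e) tail (clock x) f i))
    + \sum_(S : edges) Pr_rset z S * ((e \in S)%:R *
     (c * \sum_(s : perms) bonus (rank_of s) n (clock_min x) e (S :&: nbr e))).
  rewrite -big_split /=; apply: eq_bigr => S _.
  rewrite -mulr_sumr /win_prob -mulr_sumr /first_prob big_split /= sumr_const -cardsT.
  rewrite -[X in X + _]mulr_natl; set A := \sum_i _; set B := \sum_(s : perms) _.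
  set k := _%:R in cP *; move: cP; set y := Pr_rset _ _; set w := (e \in S)%:R.
  (* The base term does not depend on the ranking, so averaging over rankings leaves it
     unchanged. *)
  move=> cP; have -> : c * (y * (w * (k * A + B))) = (c * k) * (y * w * A) + y * (w * (c * B)).
    by ring.
  by rewrite cP; ring.
rewrite base_prob lerD2l mulrA mulr_sumr.
apply: (@le_trans _ _ (\sum_(ff | crossing u v ff) \sum_(S : edges) Pr_rset z S * ((e \in S)%:R *
       ((S :&: nbr e == [set ff.1; ff.2])%:R * (bonus_size [set ff.1; ff.2] / 6))))).
  by apply: ler_sum => ff cr; apply: crossing_term.
rewrite exchange_big /=; apply: ler_sum => S _.
rewrite -mulr_sumr -mulr_sumr ler_wpM2l //.
  apply: Pr_rset_ge0 => f; rewrite ffunE hit_ge0 ?hit_le1 //.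
rewrite ler_wpM2l //; apply: le_trans (mean_bonus_ge _).
by apply: ler_sum => ff _; case: eqP => [->|_]; rewrite ?mul0r.
Qed.

End Balance.

Lemma race_scheme_balanced (x : {ffun edge G -> R}) e :
    scaled_polytope 1 (matchings G) x -> e \in supp x -> (2500 <= n)%N ->
  ((1 - expR (- 2)) / 2 + 3 / 10 ^+ 4) * x e <= Pr_selected race_scheme x e.
Proof.
move=> x_in; rewrite inE => xe0 n_large.
have x0 := polytope_ge0 x_in.
have xe : 0 < x e by rewrite lt_neqAle eq_sym xe0 x0.
have /cards2P[u [v [uv e_ends]]] : #|ends e| == 2%N by rewrite card_ends.
apply: le_trans (Pr_selected_race_ge x_in uv e_ends).
have sE : x e + \sum_(f in nbr e) x f = \sum_(f | (u \in ends f) || (v \in ends f)) x f.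
  rewrite [RHS](bigD1 e) /=; last by rewrite e_ends !inE eqxx.
  congr (_ + _); apply: eq_bigl => f; rewrite inE /adj andbC eq_sym; congr (_ && _).
  rewrite e_ends disjoints_subset subUset !sub1set !inE negb_and !negbK //.
have y0 : 0 <= \sum_(f in nbr e) x f by apply: sumr_ge0.
have r := @race R (4 * n) N_gt0 (x e) _ xe y0.
apply: le_trans (lerD r (lexx _)); rewrite -mulrDr mulrC ler_pM2l //.
apply: race_bound.
- rewrite ltr_wpDr //= sE.
  have du := degree_le1 x_in u; have dv := degree_le1 x_in v.
  apply: (@le_trans _ _ (\sum_(f | u \in ends f) x f + \sum_(f | v \in ends f) x f)); last by lra.
  rewrite !(big_mkcond _ x) -big_split /=; apply: ler_sum => f _.
  by have := x0 f; do 2!case: (_ \in _); rewrite /= ?addr0 ?add0r // => h; rewrite lerDl.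
- by apply: sumr_ge0 => ff _; rewrite mulr_ge0.
- by rewrite sE; apply: crossing_sum_ge.
(* This brings the error [1 / (4 n)] of [race] below the [eps] allowed by [race_bound]. *)
have n4 : 10 ^+ 4 <= (4 * n)%:R :> R.
  have : 2500%:R <= n%:R :> R by rewrite ler_nat.
  by rewrite natrM; lra.
by rewrite -div1r ler_pM2l // lef_pV2 ?posrE //; lra.
Qed.

End Scheme.

Theorem theorem9 (R : realType) (G : multigraph) :
  exists pi : selector R (edge G),
    balanced_CR_scheme 1 ((1 - expR (- 2)) / 2 + 3 / 10 ^+ 4) (matchings G) pi
    /\ monotone_selector 1 (matchings G) pi.
Proof.
have [n n0 n_large] : exists2 n : nat, (0 < n)%N & (2500 <= n)%N by exists 2500%N.
exists (race_scheme n0); split=> x x_in; last first.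
  by move=> e A B eA AB _; apply: race_scheme_monotone.
split=> [A _ S|e eS]; first exact: race_scheme_valid.
exact: race_scheme_balanced.
Qed.
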